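(* Let $a,b>0$ with $ab>1$. If $a=b$, then $Q(a,b;t)=0$ for every $t>b$. If $a<b$, then there exists $t>b$ such that $Q(a,b;t)=0$.
   Context: For real $a,b,t>0$ with $1/t<1/a<b<t$ let $v_1<\dots<v_8$ be $-t,-a,-1/b,-1/t,1/t,1/a,b,t$, let $f_1(x)=|x+a|^{1/2}|x+1/b|^{-1/2}|x-1/a|^{1/2}|x-b|^{-1/2}|(x^2-t^2)(x^2-t^{-2})|^{-1/2}$ and $f_2(x)=|x+a|^{-1/2}|x+1/b|^{1/2}|x-1/a|^{-1/2}|x-b|^{1/2}|(x^2-t^2)(x^2-t^{-2})|^{-1/2}$, $I_k=\int_{v_k}^{v_{k+1}}f_1\,dx$, $J_k=\int_{v_k}^{v_{k+1}}f_2\,dx$, and $Q(a,b;t)=\frac{I_1+I_3}{I_2}-\frac{J_1+J_3}{J_2}$. (These are the edge lengths, for Lopez–Ros factor $\rho=1$, of the images of the upper half-plane under $\int\phi_1,\int\phi_2$ for the Weierstrass data of the surfaces in the class $\mathcal O$; $Q=0$ is the period condition.) *)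

(* Defs.v *)
From Stdlib Require Import Reals.
Open Scope R_scope.

Definition hp (y : R) : R := sqrt (Rabs y).

Definition wt (t x : R) : R := / hp ((x ^ 2 - t ^ 2) * (x ^ 2 - (/ t) ^ 2)).

Definition f1 (a b t x : R) : R :=
  hp (x + a) * / hp (x + / b) * hp (x - / a) * / hp (x - b) * wt t x.

Definition f2 (a b t x : R) : R :=
  / hp (x + a) * hp (x + / b) * / hp (x - / a) * hp (x - b) * wt t x.

Definition improper_integral (f : R -> R) (c d L : R) : Prop :=
  forall eps : R, 0 < eps ->
  exists delta : R, 0 < delta /\
    forall x y : R, c < x < c + delta -> d - delta < y < d -> x <= y ->
      exists pr : Riemann_integrable f x y, Rabs (RiemannInt pr - L) < eps.

Definition Q_value (a b t q : R) : Prop :=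
  exists I1 I2 I3 J1 J2 J3 : R,
    improper_integral (f1 a b t) (- t) (- a) I1 /\
    improper_integral (f1 a b t) (- a) (- / b) I2 /\
    improper_integral (f1 a b t) (- / b) (- / t) I3 /\
    improper_integral (f2 a b t) (- t) (- a) J1 /\
    improper_integral (f2 a b t) (- a) (- / b) J2 /\
    improper_integral (f2 a b t) (- / b) (- / t) J3 /\
    q = (I1 + I3) / I2 - (J1 + J3) / J2.

(* Main.v *)
Require Import Defs.
From Stdlib Require Import Reals Lra Psatz FunctionalExtensionality Ranalysis5.
From Coquelicot Require Import Coquelicot.
Open Scope R_scope.

(** The substitution [s = x - 1/x] sends [-t, -a, -1/b, -1/t] to
    [-T < P < B < T], with [T = t - 1/t], [P = 1/a - a], [B = b - 1/b], and
    turns [f1 dx] and [f2 dx] into [|s - P| W ds] and [|s - B| W ds], where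
    [W = 1 / sqrt (|(s - P) (s - B) (s^2 - T^2)| (s^2 + 4))]. The further
    substitution [s = (c + d)/2 + (d - c)/2 sin u] removes the endpoint
    singularities on each interval [(c, d)], so the six edge lengths are
    proper integrals depending continuously on [T].

    If [a = b], then [P = -B] and [s -> -s] exchanges the two families of edges.
    If [a < b], then [-B < P < B] and one applies the intermediate value theorem
    to [det = (I1 + I3) J2 - (J1 + J3) I2] on [T > B]. As [T -> B], [I2] diverges
    logarithmically while [I1], [I3], [J2] stay bounded and [J1] stays away from
    [0], so [det < 0]. As [T -> oo], [T I3] diverges logarithmically, [T I2] is
    bounded, [T (J2 - I2)] tends to a positive limit, and reflection [s -> -s]
    shows [J3 <= I1] and [J1 <= I3 + O(1/T)]; hence [det > 0]. *)

(** * Integrals against the arcsine weight *)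

(** The integral of [k s / sqrt ((s - c) * (d - s))] over [(c, d)], written in the angle [u], whose
    differential absorbs the singular weight. It is not normalised: the constant 1 gives [PI]. *)
Definition arcmean (c d : R) (k : R -> R) : R :=
  RInt (fun u => k ((c + d) / 2 + (d - c) / 2 * sin u)) (- (PI / 2)) (PI / 2).

Lemma arc_between (c d u : R) : c <= d ->
  c <= (c + d) / 2 + (d - c) / 2 * sin u <= d.
Proof. intros H; pose proof (SIN_bound u); nra. Qed.

Lemma arc_between_strict (c d u : R) : c < d -> - (PI / 2) < u < PI / 2 ->
  c < (c + d) / 2 + (d - c) / 2 * sin u < d.
Proof.
  intros H [H1 H2].
  assert (sin (- (PI / 2)) < sin u) by (apply sin_increasing_1; lra).
  assert (sin u < sin (PI / 2)) by (apply sin_increasing_1; lra).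
  rewrite sin_neg, sin_PI2 in *; nra.
Qed.

Lemma continuous_arc (c d : R) (k : R -> R) (u : R) : c <= d ->
  (forall s, c <= s <= d -> continuous k s) ->
  continuous (fun u => k ((c + d) / 2 + (d - c) / 2 * sin u)) u.
Proof.
  intros Hcd Hk.
  apply (continuous_comp (fun u => (c + d) / 2 + (d - c) / 2 * sin u) k).
  - apply (ex_derive_continuous (fun u => (c + d) / 2 + (d - c) / 2 * sin u)).
    auto_derive; auto.
  - apply Hk, arc_between, Hcd.
Qed.

Lemma ex_RInt_arc (c d : R) (k : R -> R) (u v : R) : c <= d ->
  (forall s, c <= s <= d -> continuous k s) ->
  ex_RInt (fun u => k ((c + d) / 2 + (d - c) / 2 * sin u)) u v.
Proof.
  intros Hcd Hk; apply (ex_RInt_continuous (V := R_CompleteNormedModule)).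
  intros z _; apply continuous_arc; assumption.
Qed.

Lemma arcmean_le_const (c d : R) (k : R -> R) (M : R) : c <= d ->
  (forall s, c <= s <= d -> continuous k s) ->
  (forall s, c <= s <= d -> k s <= M) -> arcmean c d k <= PI * M.
Proof.
  intros Hcd Hk HM; pose proof PI_RGT_0.
  replace (PI * M) with (RInt (fun _ => M) (- (PI / 2)) (PI / 2)).
  - apply RInt_le; [lra | apply ex_RInt_arc; assumption | apply ex_RInt_const |].
    intros; apply HM, arc_between, Hcd.
  - rewrite RInt_const; unfold scal; simpl; unfold mult; simpl; field.
Qed.

Lemma arcmean_gt_0 (c d : R) (k : R -> R) : c < d ->
  (forall s, c <= s <= d -> continuous k s) ->
  (forall s, c < s < d -> 0 < k s) -> 0 < arcmean c d k.
Proof.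
  intros Hcd Hk Hp; pose proof PI_RGT_0; apply RInt_gt_0; [lra | |].
  - intros u Hu; apply Hp, arc_between_strict; assumption.
  - intros; apply continuous_arc; [lra | assumption].
Qed.

Lemma is_RInt_reflect (f : R -> R) (a b l : R) :
  is_RInt f (- b) (- a) l -> is_RInt (fun x => f (- x)) a b l.
Proof.
  intros H; apply is_RInt_swap in H.
  apply (is_RInt_comp_opp (V := R_NormedModule)) in H.
  apply (is_RInt_opp (V := R_NormedModule)) in H.
  rewrite opp_opp in H.
  apply (is_RInt_ext (V := R_NormedModule)) with (2 := H).
  intros; apply opp_opp.
Qed.

Lemma arcmean_opp (c d : R) (k : R -> R) : c <= d ->
  (forall s, c <= s <= d -> continuous k s) ->
  arcmean (- d) (- c) (fun s => k (- s)) = arcmean c d k.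
Proof.
  intros Hcd Hk; unfold arcmean.
  set (g := fun u => k ((c + d) / 2 + (d - c) / 2 * sin u)).
  apply is_RInt_unique.
  apply (is_RInt_ext (V := R_NormedModule) (fun u => g (- u))).
  - intros u _; unfold g; rewrite sin_neg; f_equal; field.
  - apply is_RInt_reflect; rewrite Ropp_involutive.
    apply (RInt_correct (V := R_CompleteNormedModule)), ex_RInt_arc; assumption.
Qed.

(** Continuity of [asin] at the endpoint where its derivative blows up, drawn from the monotonicity
    of [sin]. Oddness of [asin] yields the other endpoint. *)
Lemma asin_near_m1 (eta : R) : 0 < eta ->
  exists v, -1 < v /\ forall u, -1 <= u < v -> asin u < - (PI / 2) + eta.
Proof.
  intros He; pose proof PI_RGT_0.
  (* The cap [PI / 2] keeps [- (PI / 2) + e] in the range where [sin] is increasing. *)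
  set (e := Rmin eta (PI / 2)).
  assert (He' : 0 < e <= PI / 2 /\ e <= eta).
  { unfold e; repeat split; try apply Rmin_glb_lt; try apply Rmin_l;
      try apply Rmin_r; lra. }
  exists (sin (- (PI / 2) + e)); split.
  - replace (-1) with (sin (- (PI / 2))) by (rewrite sin_neg, sin_PI2; reflexivity).
    apply sin_increasing_1; lra.
  - intros u Hu; pose proof (SIN_bound (- (PI / 2) + e)).
    apply Rlt_le_trans with (- (PI / 2) + e); [| lra].
    pose proof (asin_bound u).
    apply sin_increasing_0; try lra.
    rewrite sin_asin; lra.
Qed.

Lemma is_derive_asin (x : R) : -1 < x < 1 -> is_derive asin x (/ sqrt (1 - x²)).
Proof.
  intros Hx; apply is_derive_Reals.
  replace (/ sqrt (1 - x²)) with (1 / sqrt (1 - x²)) by (unfold Rdiv; ring).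
  rewrite <- (derive_pt_asin x Hx).
  apply derive_pt_eq_1 with (derivable_pt_asin x Hx); reflexivity.
Qed.

(** With [ph] the affine rescaling of [sg] to [(-1, 1)], the derivative of [asin (ph x)] is
    [dsg x / sqrt ((sg x - c) * (d - sg x))]. A truncated integral of [f] is thus a proper integral
    of the bounded function [g] over a slightly shorter range of angles, and the two missing tails
    vanish in the limit. The map [sg] is later the identity or [x - / x]. *)
Lemma improper_integral_arcmean (sg dsg k f : R -> R) (C D c d : R) :
  c < d -> C < D ->
  continuous sg C -> continuous sg D -> sg C = c -> sg D = d ->
  (forall x, C < x < D ->
     c < sg x < d /\ is_derive sg x (dsg x) /\ continuous dsg x) ->
  (forall s, c <= s <= d -> continuous k s) ->
  (forall x, C < x < D ->
     f x = dsg x * (k (sg x) / sqrt ((sg x - c) * (d - sg x)))) ->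
  improper_integral f C D (arcmean c d k).
Proof.
  intros Hcd HCD HC HD sC sD Hsg Hk Hf eps Heps.
  pose proof PI_RGT_0 as Hpi.
  set (g := fun u => k ((c + d) / 2 + (d - c) / 2 * sin u)).
  assert (gc : forall u, continuous g u)
    by (intros; apply continuous_arc; [lra | assumption]).
  assert (gi : forall u v, ex_RInt g u v)
    by (intros; apply ex_RInt_arc; [lra | assumption]).
  set (ph := fun x => (sg x - (c + d) / 2) / ((d - c) / 2)).
  assert (gb : exists M, 0 < M /\
            forall u, - (PI / 2) <= u <= PI / 2 -> Rabs (g u) <= M).
  { destruct (continuity_ab_maj (fun u => Rabs (g u)) (- (PI / 2)) (PI / 2))
      as [m [Hm _]]; [lra | |].
    - intros z _; apply continuity_pt_filterlim.
      apply (continuous_comp g Rabs); [apply gc | apply continuous_Rabs].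
    (* The added 1 makes [M] positive, as the division in [eta] requires. *)
    - exists (Rabs (g m) + 1); split; [pose proof (Rabs_pos (g m)); lra |].
      intros u Hu; specialize (Hm u Hu); simpl in Hm; lra. }
  destruct gb as [M [HM gb]].
  assert (phb : forall x, C < x < D -> -1 < ph x < 1).
  { intros x Hx; destruct (Hsg x Hx) as [Hs _]; unfold ph; split.
    - apply Rmult_lt_reg_r with ((d - c) / 2); [lra |]; unfold Rdiv at 2.
      rewrite Rmult_assoc, Rinv_l; lra.
    - apply Rmult_lt_reg_r with ((d - c) / 2); [lra |]; unfold Rdiv at 1.
      rewrite Rmult_assoc, Rinv_l; lra. }
  assert (sub : forall x y, C < x -> x <= y -> y < D ->
            is_RInt f x y (RInt g (asin (ph x)) (asin (ph y)))).
  { intros x y Hx Hxy Hy.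
    apply is_RInt_ext with
      (f := fun z => scal (dsg z / sqrt ((sg z - c) * (d - sg z)))
                          (g (asin (ph z)))).
    - intros z; rewrite Rmin_left, Rmax_right by assumption; intros Hz.
      rewrite Hf by lra; unfold g; rewrite sin_asin.
      2: { pose proof (phb z); lra. }
      unfold scal; simpl; unfold mult; simpl.
      replace ((c + d) / 2 + (d - c) / 2 * ph z) with (sg z)
        by (unfold ph; field; lra).
      unfold Rdiv; ring.
    - apply (is_RInt_comp (V := R_CompleteNormedModule) g (fun z => asin (ph z))).
      + intros; apply gc.
      + intros z; rewrite Rmin_left, Rmax_right by assumption; intros Hz.
        destruct (Hsg z) as [Hs [Hd Hc]]; [lra |].
        assert (Hq : 0 < (sg z - c) * (d - sg z)) by nra.
        split.
        * replace (dsg z / sqrt ((sg z - c) * (d - sg z)))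
            with (scal (dsg z / ((d - c) / 2)) (/ sqrt (1 - (ph z)²))).
          -- apply (is_derive_comp asin ph).
             ++ apply is_derive_asin, phb; lra.
             ++ unfold ph.
                apply (is_derive_ext (fun x => (/ ((d - c) / 2)) * (sg x - (c + d) / 2))).
                { intros; unfold Rdiv; apply Rmult_comm. }
                replace (dsg z / ((d - c) / 2))
                  with ((/ ((d - c) / 2)) * (dsg z - 0)) by (field; lra).
                apply (is_derive_scal (fun x => sg x - (c + d) / 2)).
                apply (is_derive_minus (V := R_NormedModule) sg (fun _ => (c + d) / 2));
                  [assumption | apply (is_derive_const (V := R_NormedModule))].
          -- unfold scal; simpl; unfold mult; simpl.
             replace (1 - (ph z)²)
               with ((sg z - c) * (d - sg z) / ((d - c) / 2 * ((d - c) / 2)))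
               by (unfold ph, Rsqr; field; lra).
             rewrite sqrt_div by nra.
             rewrite sqrt_square by lra.
             assert (Hs0 := Rgt_not_eq _ _ (sqrt_lt_R0 _ Hq)).
             field; repeat split; lra.
        * apply (continuous_mult (K := R_AbsRing) dsg
                   (fun z => / sqrt ((sg z - c) * (d - sg z)))); [assumption |].
          assert (cs : continuous sg z)
            by (apply (ex_derive_continuous (V := R_NormedModule)); eexists; exact Hd).
          apply continuous_Rinv_comp.
          -- apply continuous_sqrt_comp.
             apply (continuous_mult (K := R_AbsRing)
                      (fun z => sg z - c) (fun z => d - sg z)).
             ++ apply (continuous_minus (V := R_NormedModule) sg (fun _ => c));
                  [assumption | apply continuous_const].
             ++ apply (continuous_minus (V := R_NormedModule) (fun _ => d) sg);
                  [apply continuous_const | assumption].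
          -- apply Rgt_not_eq, sqrt_lt_R0, Hq. }
  (* Each tail has angular length below [eta], hence costs at most [eta * M = eps / 4]. *)
  set (eta := eps / (4 * M)).
  assert (Heta : 0 < eta) by (unfold eta; apply Rdiv_lt_0_compat; lra).
  destruct (asin_near_m1 eta Heta) as [v [Hv1 Hv2]].
  (* In terms of [sg], the condition [ph x < v] reads [sg x - c < (d - c) / 2 * (v + 1)]. *)
  assert (Hr : 0 < (d - c) / 2 * (v + 1)) by nra.
  assert (nC : exists dl, 0 < dl /\ forall x, Rabs (x - C) < dl ->
             Rabs (sg x - c) < (d - c) / 2 * (v + 1)).
  { apply continuity_pt_filterlim in HC.
    destruct (proj1 (continuity_pt_locally sg C) HC (mkposreal _ Hr)) as [dl Hdl].
    rewrite sC in Hdl; exists dl; split; [apply cond_pos | exact Hdl]. }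
  assert (nD : exists dl, 0 < dl /\ forall x, Rabs (x - D) < dl ->
             Rabs (sg x - d) < (d - c) / 2 * (v + 1)).
  { apply continuity_pt_filterlim in HD.
    destruct (proj1 (continuity_pt_locally sg D) HD (mkposreal _ Hr)) as [dl Hdl].
    rewrite sD in Hdl; exists dl; split; [apply cond_pos | exact Hdl]. }
  destruct nC as [d1 [Hd1 nC]], nD as [d2 [Hd2 nD]].
  exists (Rmin d1 d2); split; [apply Rmin_glb_lt; assumption |].
  intros x y Hx Hy Hxy.
  pose proof (Rmin_l d1 d2); pose proof (Rmin_r d1 d2).
  assert (HxC : C < x) by lra. assert (HyD : y < D) by lra.
  pose proof (sub x y HxC Hxy HyD) as HI.
  assert (ax : asin (ph x) < - (PI / 2) + eta).
  { apply Hv2; split; [pose proof (phb x); lra |].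
    specialize (nC x); rewrite Rabs_pos_eq in nC by lra.
    specialize (nC ltac:(lra)); apply Rabs_def2 in nC.
    unfold ph; apply Rmult_lt_reg_r with ((d - c) / 2); [lra |].
    unfold Rdiv at 1; rewrite Rmult_assoc, Rinv_l; lra. }
  assert (ay : PI / 2 - eta < asin (ph y)).
  { enough (asin (- ph y) < - (PI / 2) + eta) by (rewrite asin_opp in *; lra).
    apply Hv2; split; [pose proof (phb y); lra |].
    specialize (nD y); rewrite Rabs_left in nD by lra.
    specialize (nD ltac:(lra)); apply Rabs_def2 in nD.
    unfold ph; apply Rmult_lt_reg_r with ((d - c) / 2); [lra |].
    unfold Rdiv at 1; rewrite <- Ropp_mult_distr_l, Rmult_assoc, Rinv_l; lra. }
  exists (ex_RInt_Reals_0 _ _ _ (ex_intro _ _ HI)).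
  rewrite <- RInt_Reals, (is_RInt_unique _ _ _ _ HI).
  unfold arcmean; fold g.
  pose proof (asin_bound (ph x)); pose proof (asin_bound (ph y)).
  rewrite <- (RInt_Chasles g (- (PI / 2)) (asin (ph x)) (PI / 2)) by apply gi.
  rewrite <- (RInt_Chasles g (asin (ph x)) (asin (ph y)) (PI / 2)) by apply gi.
  unfold plus; simpl.
  set (A1 := RInt g (- (PI / 2)) (asin (ph x))).
  set (A2 := RInt g (asin (ph y)) (PI / 2)).
  assert (Rabs A1 <= (asin (ph x) - - (PI / 2)) * M)
    by (apply abs_RInt_le_const; [lra | apply gi | intros; apply gb; lra]).
  assert (Rabs A2 <= (PI / 2 - asin (ph y)) * M)
    by (apply abs_RInt_le_const; [lra | apply gi | intros; apply gb; lra]).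
  replace (_ - _) with (- (A1 + A2)) by ring.
  rewrite Rabs_Ropp.
  apply Rle_lt_trans with (1 := Rabs_triang _ _).
  assert (eta * M = eps / 4) by (unfold eta; field; lra).
  nra.
Qed.

(** * Improper integrals and edge lengths *)

(** The definition grants integrability only between points close to the ends; it passes from such a
    larger interval to the given one. *)
Lemma improper_integral_ex_RInt (f : R -> R) (c d L x y : R) :
  improper_integral f c d L -> c < x -> x <= y -> y < d -> ex_RInt f x y.
Proof.
  intros H Hx Hxy Hy.
  destruct (H 1 Rlt_0_1) as [dl [Hdl Hi]].
  (* The minimum places [x'] both to the left of [x] and within [dl] of [c]; [y'] is its mirror
     image. *)
  set (x' := c + Rmin (x - c) dl / 2); set (y' := d - Rmin (d - y) dl / 2).
  pose proof (Rmin_l (x - c) dl); pose proof (Rmin_r (x - c) dl).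
  pose proof (Rmin_l (d - y) dl); pose proof (Rmin_r (d - y) dl).
  assert (0 < Rmin (x - c) dl) by (apply Rmin_glb_lt; lra).
  assert (0 < Rmin (d - y) dl) by (apply Rmin_glb_lt; lra).
  destruct (Hi x' y') as [pr _]; try (unfold x', y'; lra).
  apply (ex_RInt_Chasles_2 (V := R_CompleteNormedModule)) with x'; [unfold x'; lra |].
  apply (ex_RInt_Chasles_1 (V := R_CompleteNormedModule)) with y'; [unfold x', y'; lra |].
  apply ex_RInt_Reals_1, pr.
Qed.

Lemma improper_integral_ge (f : R -> R) (c d L x y : R) :
  improper_integral f c d L -> (forall s, c < s < d -> 0 <= f s) ->
  c < x -> x <= y -> y < d -> RInt f x y <= L.
Proof.
  intros H Hp Hx Hxy Hy.
  apply Rle_plus_epsilon; intros eps Heps.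
  destruct (H eps Heps) as [dl [Hdl Hi]].
  set (x' := c + Rmin (x - c) dl / 2); set (y' := d - Rmin (d - y) dl / 2).
  pose proof (Rmin_l (x - c) dl); pose proof (Rmin_r (x - c) dl).
  pose proof (Rmin_l (d - y) dl); pose proof (Rmin_r (d - y) dl).
  assert (0 < Rmin (x - c) dl) by (apply Rmin_glb_lt; lra).
  assert (0 < Rmin (d - y) dl) by (apply Rmin_glb_lt; lra).
  assert (c < x' < x) by (unfold x'; lra).
  assert (y < y' < d) by (unfold y'; lra).
  destruct (Hi x' y') as [pr Hpr]; try (unfold x', y'; lra).
  rewrite <- RInt_Reals in Hpr.
  assert (E : forall u v, x' <= u -> u <= v -> v <= y' -> ex_RInt f u v)
    by (intros; apply improper_integral_ex_RInt with c d L; lra || assumption).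
  rewrite <- (RInt_Chasles f x' x y') in Hpr by (apply E; lra).
  rewrite <- (RInt_Chasles f x y y') in Hpr by (apply E; lra).
  unfold plus in Hpr; simpl in Hpr.
  assert (0 <= RInt f x' x)
    by (apply RInt_ge_0; [lra | apply E; lra | intros; apply Hp; lra]).
  assert (0 <= RInt f y y')
    by (apply RInt_ge_0; [lra | apply E; lra | intros; apply Hp; lra]).
  apply Rabs_def2 in Hpr; lra.
Qed.

(** The bound is required only for intervals straddling [z], so an estimate may cut the integral at
    [z]. *)
Lemma improper_integral_le (f : R -> R) (c z d L M : R) :
  improper_integral f c d L -> c < z < d ->
  (forall x y, c < x < z -> z < y < d -> RInt f x y <= M) -> L <= M.
Proof.
  intros H Hz HM.
  apply Rle_plus_epsilon; intros eps Heps.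
  destruct (H eps Heps) as [dl [Hdl Hi]].
  set (r := Rmin (Rmin (z - c) (d - z)) dl).
  assert (Hr : 0 < r) by (repeat apply Rmin_glb_lt; lra).
  assert (r <= dl) by apply Rmin_r.
  assert (r <= Rmin (z - c) (d - z)) by apply Rmin_l.
  pose proof (Rmin_l (z - c) (d - z)); pose proof (Rmin_r (z - c) (d - z)).
  destruct (Hi (c + r / 2) (d - r / 2)) as [pr Hpr]; try lra.
  rewrite <- RInt_Reals in Hpr; apply Rabs_def2 in Hpr.
  pose proof (HM (c + r / 2) (d - r / 2)).
  lra.
Qed.

(** Joint continuity on a compact segment is uniform in [u], so the integrands are uniformly
    close. *)
Lemma continuity_RInt_param (f : R -> R -> R) (a b v : R) : a <= b ->
  (forall u, a <= u <= b -> continuity_2d_pt f v u) ->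
  locally v (fun w => ex_RInt (f w) a b) ->
  continuity_pt (fun w => RInt (f w) a b) v.
Proof.
  intros Hab Hf [dl0 Hi]; apply continuity_pt_locally; intros eps.
  (* The 1 added to [b - a] covers the degenerate case [a = b]. *)
  assert (He : 0 < eps / (2 * (b - a + 1)))
    by (apply Rdiv_lt_0_compat; [apply cond_pos | lra]).
  destruct (uniform_continuity_2d_1d' f a b v Hf (mkposreal _ He)) as [dl Hdl].
  exists (mkposreal _ (Rmin_pos _ _ (cond_pos dl0) (cond_pos dl))); intros w Hw.
  unfold ball in Hw; simpl in Hw; unfold AbsRing_ball, abs, minus, plus, opp in Hw.
  simpl in Hw.
  pose proof (Rmin_l dl0 dl); pose proof (Rmin_r dl0 dl).
  assert (iw : ex_RInt (f w) a b).
  { apply Hi; unfold ball; simpl; unfold AbsRing_ball, abs, minus, plus, opp; simpl.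
    lra. }
  assert (iv : ex_RInt (f v) a b) by (apply Hi, ball_center).
  replace (RInt (f w) a b - RInt (f v) a b)
    with (RInt (fun u => minus (f w u) (f v u)) a b)
    by (rewrite (RInt_minus (V := R_CompleteNormedModule)) by assumption; reflexivity).
  apply Rle_lt_trans with ((b - a) * (eps / (2 * (b - a + 1)))).
  - apply abs_RInt_le_const; [assumption | apply (ex_RInt_minus (V := R_NormedModule)); assumption |].
    intros u Hu; apply Rlt_le.
    apply Rabs_def2 in Hw.
    apply (Hdl u v u w); try lra; pose proof (cond_pos dl); try lra.
    rewrite Rminus_diag, Rabs_R0; apply cond_pos.
  - apply Rmult_lt_reg_r with (2 * (b - a + 1)); [lra |].
    replace ((b - a) * (eps / (2 * (b - a + 1))) * (2 * (b - a + 1)))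
      with ((b - a) * eps) by (field; lra).
    pose proof (cond_pos eps); nra.
Qed.

(* On [(c, d)] with the remaining branch points [e], [f], the edge integrand is
   [kern e f p s / sqrt ((s - c) (d - s))]. *)
Definition kern (e f p s : R) : R :=
  Rabs (s - p) / sqrt (Rabs ((s - e) * (s - f)) * (s ^ 2 + 4)).

Definition Edge (c d e f p : R) : R := arcmean c d (kern e f p).

(** The four branch points enter symmetrically, so one integrand can be read as [dens] on each of
    the three intervals. *)
Definition dens (c d e f p s : R) : R :=
  Rabs (s - p) /
  sqrt (Rabs ((s - c) * (s - d) * (s - e) * (s - f)) * (s ^ 2 + 4)).

Lemma kern_den_gt_0 (e f s : R) : s <> e -> s <> f ->
  0 < sqrt (Rabs ((s - e) * (s - f)) * (s ^ 2 + 4)).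
Proof.
  intros He Hf; apply sqrt_lt_R0, Rmult_lt_0_compat; [| nra].
  apply Rabs_pos_lt, Rmult_integral_contrapositive_currified; lra.
Qed.

Lemma continuous_kern (e f p s : R) : s <> e -> s <> f -> continuous (kern e f p) s.
Proof.
  intros He Hf; unfold kern.
  apply (continuous_mult (K := R_AbsRing) (fun s => Rabs (s - p))
    (fun s => / sqrt (Rabs ((s - e) * (s - f)) * (s ^ 2 + 4)))).
  - apply continuous_Rabs_comp.
    apply (ex_derive_continuous (V := R_NormedModule)); auto_derive; auto.
  - apply continuous_Rinv_comp; [| apply Rgt_not_eq, kern_den_gt_0; assumption].
    apply continuous_sqrt_comp.
    apply (continuous_mult (K := R_AbsRing) (fun s => Rabs ((s - e) * (s - f)))
      (fun s => s ^ 2 + 4)).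
    + apply continuous_Rabs_comp.
      apply (ex_derive_continuous (V := R_NormedModule)); auto_derive; auto.
    + apply (ex_derive_continuous (V := R_NormedModule)); auto_derive; auto.
Qed.

Lemma kern_dens (c d e f p s : R) : c < s < d -> s <> e -> s <> f ->
  kern e f p s / sqrt ((s - c) * (d - s)) = dens c d e f p s.
Proof.
  intros Hs He Hf; unfold kern, dens.
  replace ((s - c) * (s - d) * (s - e) * (s - f))
    with (- ((s - c) * (d - s) * ((s - e) * (s - f)))) by ring.
  rewrite Rabs_Ropp, (Rabs_mult ((s - c) * (d - s))), (Rabs_pos_eq ((s - c) * (d - s)))
    by nra.
  rewrite (Rmult_assoc ((s - c) * (d - s))).
  rewrite (sqrt_mult ((s - c) * (d - s))).
  - assert (H := kern_den_gt_0 e f s He Hf).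
    assert (0 < sqrt ((s - c) * (d - s))) by (apply sqrt_lt_R0; nra).
    field; lra.
  - nra.
  - apply Rmult_le_pos; [apply Rabs_pos | nra].
Qed.

(** Branch points off the closed interval keep [kern] continuous up to the ends. *)
Definition outside (e c d : R) : Prop := e < c \/ d < e.

Lemma outside_neq (e c d s : R) : outside e c d -> c <= s <= d -> s <> e.
Proof. unfold outside; lra. Qed.

Lemma improper_integral_dens (c d e f p : R) : c < d ->
  outside e c d -> outside f c d ->
  improper_integral (dens c d e f p) c d (Edge c d e f p).
Proof.
  intros Hcd He Hf.
  apply (improper_integral_arcmean (fun s => s) (fun _ => 1)); try assumption;
    try apply continuous_id; try reflexivity.
  - intros x Hx; split; [assumption | split].
    + apply (is_derive_id (K := R_AbsRing)).
    + apply continuous_const.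
  - intros s Hs; apply continuous_kern; apply outside_neq with c d; assumption.
  - intros s Hs; rewrite Rmult_1_l; symmetry; apply kern_dens; [assumption | |];
      apply outside_neq with c d; lra || assumption.
Qed.

Lemma joukowski_lt (x y : R) : x < y < 0 -> x - / x < y - / y.
Proof.
  intros H.
  assert (/ y < / x) by (apply Rinv_lt_contravar; nra).
  lra.
Qed.

(** On the negative axis [x - / x] is increasing with derivative [1 + / x ^ 2], so it is an
    admissible substitution. *)
Lemma improper_integral_joukowski (g : R -> R) (C D c d e f p : R) :
  C < D < 0 -> c = C - / C -> d = D - / D ->
  outside e c d -> outside f c d ->
  (forall x, C < x < D -> g x = (1 + / x ^ 2) * dens c d e f p (x - / x)) ->
  improper_integral g C D (Edge c d e f p).
Proof.
  intros HCD Hc Hd He Hf Hg.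
  assert (Hcd : c < d) by (subst; apply joukowski_lt; lra).
  apply (improper_integral_arcmean (fun x => x - / x) (fun x => 1 + / x ^ 2));
    try assumption; try lra.
  - apply (ex_derive_continuous (V := R_NormedModule)); auto_derive; lra.
  - apply (ex_derive_continuous (V := R_NormedModule)); auto_derive; lra.
  - intros x Hx; split; [| split].
    + subst; split; apply joukowski_lt; lra.
    + auto_derive; [lra | field; lra].
    + apply (ex_derive_continuous (V := R_NormedModule)); auto_derive.
      apply Rgt_not_eq; nra.
  - intros s Hs; apply continuous_kern; apply outside_neq with c d; assumption.
  - intros x Hx; rewrite Hg by assumption.
    assert (c < x - / x < d) by (subst; split; apply joukowski_lt; lra).
    rewrite kern_dens; [reflexivity | assumption | |];
      apply outside_neq with c d; lra || assumption.
Qed.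

Lemma Edge_opp (c d e f p : R) : c <= d -> outside e c d -> outside f c d ->
  Edge (- d) (- c) (- f) (- e) (- p) = Edge c d e f p.
Proof.
  intros Hcd He Hf; unfold Edge.
  rewrite <- (arcmean_opp c d).
  - f_equal; apply functional_extensionality; intros s; unfold kern.
    replace (- s - p) with (- (s - - p)) by ring.
    rewrite Rabs_Ropp.
    replace ((- s - e) * (- s - f)) with ((s - - f) * (s - - e)) by ring.
    replace ((- s) ^ 2) with (s ^ 2) by ring; reflexivity.
  - assumption.
  - intros s Hs; apply continuous_kern; apply outside_neq with c d; assumption.
Qed.

Lemma Edge_gt_0 (c d e f p : R) : c < d -> outside e c d -> outside f c d ->
  (p <= c \/ d <= p) -> 0 < Edge c d e f p.
Proof.
  intros Hcd He Hf Hp; apply arcmean_gt_0; [assumption | |].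
  - intros s Hs; apply continuous_kern; apply outside_neq with c d; assumption.
  - intros s Hs; apply Rdiv_lt_0_compat.
    + apply Rabs_pos_lt; lra.
    + apply kern_den_gt_0; apply outside_neq with c d; lra || assumption.
Qed.

Lemma continuity_pt_2d (g : R -> R) (v u : R) :
  continuity_pt g v -> continuity_2d_pt (fun v _ => g v) v u.
Proof.
  intros H; apply (continuity_1d_2d_pt_comp g (fun v _ => v));
    [assumption | apply continuity_2d_pt_id1].
Qed.

(** In the angle [u] the range of integration is fixed, so moving the endpoints only deforms a
    continuous integrand. *)
Lemma continuity_Edge (c d e f : R -> R) (p lo v : R) :
  continuity c -> continuity d -> continuity e -> continuity f ->
  (forall v, lo < v ->
     c v <= d v /\ outside (e v) (c v) (d v) /\ outside (f v) (c v) (d v)) ->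
  lo < v -> continuity_pt (fun v => Edge (c v) (d v) (e v) (f v) p) v.
Proof.
  intros Cc Cd Ce Cf H Hv; unfold Edge, arcmean; pose proof PI_RGT_0.
  apply (continuity_RInt_param (fun v u =>
     kern (e v) (f v) p ((c v + d v) / 2 + (d v - c v) / 2 * sin u))); [lra | |].
  - intros u _; destruct (H v Hv) as [Hcd [He Hf]].
    set (S := fun v u => (c v + d v) / 2 + (d v - c v) / 2 * sin u).
    assert (CS : continuity_2d_pt S v u).
    { unfold S; apply continuity_2d_pt_plus;
        [| apply continuity_2d_pt_mult].
      - apply (continuity_pt_2d (fun v => (c v + d v) / 2)); reg.
      - apply (continuity_pt_2d (fun v => (d v - c v) / 2)); reg.
      - apply (continuity_1d_2d_pt_comp sin (fun _ u => u));
          [apply continuity_sin | apply continuity_2d_pt_id2]. }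
    pose proof (arc_between (c v) (d v) u Hcd) as HS.
    apply (continuity_2d_pt_mult (fun v u => Rabs (S v u - p))
      (fun v u => / sqrt (Rabs ((S v u - e v) * (S v u - f v)) * (S v u ^ 2 + 4)))).
    + apply (continuity_1d_2d_pt_comp Rabs (fun v u => S v u - p));
        [apply Rcontinuity_abs |].
      apply continuity_2d_pt_minus; [assumption | apply continuity_2d_pt_const].
    + apply continuity_2d_pt_inv.
      2: { apply Rgt_not_eq, kern_den_gt_0; apply outside_neq with (c v) (d v);
           assumption. }
      apply (continuity_1d_2d_pt_comp sqrt
        (fun v u => Rabs ((S v u - e v) * (S v u - f v)) * (S v u ^ 2 + 4))).
      { apply continuity_pt_filterlim, continuous_sqrt. }
      apply continuity_2d_pt_mult.
      * apply (continuity_1d_2d_pt_comp Rabs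
          (fun v u => (S v u - e v) * (S v u - f v))); [apply Rcontinuity_abs |].
        apply continuity_2d_pt_mult; apply continuity_2d_pt_minus; try assumption;
          apply continuity_pt_2d; [apply Ce | apply Cf].
      * apply (continuity_1d_2d_pt_comp (fun s => s ^ 2 + 4) S); [reg | assumption].
  - assert (Hv' : 0 < v - lo) by lra; exists (mkposreal _ Hv'); intros w Hw.
    unfold ball in Hw; simpl in Hw; unfold AbsRing_ball, abs, minus, plus, opp in Hw.
    simpl in Hw; apply Rabs_def2 in Hw.
    destruct (H w) as [Hcd [He Hf]]; [lra |].
    apply ex_RInt_arc; [assumption |].
    intros s Hs; apply continuous_kern; apply outside_neq with (c w) (d w); assumption.
Qed.

(** * The substitution [s = x - 1/x] *)

(** The common integrand of all edges in the variable [s]: [p = P] belongs to [f1], [p = B] to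
    [f2]. *)
Definition flat (T P B p s : R) : R :=
  Rabs (s - p) / sqrt (Rabs ((s - P) * (s - B) * (s ^ 2 - T ^ 2)) * (s ^ 2 + 4)).

Lemma flat_dens_left (T P B p : R) : flat T P B p = dens (- T) P B T p.
Proof.
  apply functional_extensionality; intros s; unfold flat, dens.
  do 4 f_equal; ring.
Qed.

Lemma flat_dens_mid (T P B p : R) : flat T P B p = dens P B (- T) T p.
Proof.
  apply functional_extensionality; intros s; unfold flat, dens.
  do 4 f_equal; ring.
Qed.

Lemma flat_dens_right (T P B p : R) : flat T P B p = dens B T (- T) P p.
Proof.
  apply functional_extensionality; intros s; unfold flat, dens.
  do 4 f_equal; ring.
Qed.

Lemma hp_mult (x y : R) : hp (x * y) = hp x * hp y.
Proof. unfold hp; rewrite Rabs_mult; apply sqrt_mult; apply Rabs_pos. Qed.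

Lemma hp_sqr (x : R) : hp x * hp x = Rabs x.
Proof. apply sqrt_sqrt, Rabs_pos. Qed.

Lemma hp_gt_0 (x : R) : x <> 0 -> 0 < hp x.
Proof. intros; apply sqrt_lt_R0, Rabs_pos_lt; assumption. Qed.

(** Since [(x - / x) ^ 2 + 4] is the square of [x + / x], its root is rational, and the quotient of
    [1 + / x ^ 2] by it is [/ (- x)]. *)
Lemma flat_hp (T P B p x : R) : x < 0 ->
  (1 + / x ^ 2) * flat T P B p (x - / x) =
  Rabs (x - / x - p) /
  (- x * (hp (x - / x - P) * hp (x - / x - B) * hp ((x - / x) ^ 2 - T ^ 2))).
Proof.
  intros Hx; unfold flat.
  replace ((x - / x) ^ 2 + 4) with ((x + / x) * (x + / x)) by (field; lra).
  assert (Hx' : / x < 0) by (apply Rinv_lt_0_compat, Hx).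
  rewrite sqrt_mult by (try apply Rabs_pos; nra).
  replace ((x + / x) * (x + / x)) with ((- (x + / x)) * (- (x + / x))) by ring.
  rewrite sqrt_square by lra.
  fold (hp ((x - / x - P) * (x - / x - B) * ((x - / x) ^ 2 - T ^ 2))).
  rewrite !hp_mult.
  set (u := hp _ * hp _ * hp _).
  unfold Rdiv; rewrite !Rinv_mult.
  generalize (/ u); intros iu.
  assert (0 < 1 + x ^ 2) by nra.
  replace (/ - (x + / x)) with (- (x * / (1 + x ^ 2)))
    by (field; repeat split; nra).
  field; repeat split; nra.
Qed.

Lemma wt_joukowski (t x : R) : t <> 0 -> x < 0 ->
  hp ((x ^ 2 - t ^ 2) * (x ^ 2 - (/ t) ^ 2)) =
  - x * hp ((x - / x) ^ 2 - (t - / t) ^ 2).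
Proof.
  intros Ht Hx.
  replace ((x ^ 2 - t ^ 2) * (x ^ 2 - (/ t) ^ 2))
    with (x * x * ((x - / x) ^ 2 - (t - / t) ^ 2)) by (field; lra).
  rewrite !hp_mult, hp_sqr, Rabs_left by assumption; ring.
Qed.

(** The points [c] and [- / c] are the two preimages of [c - / c] under [x - / x]. *)
Lemma hp_pair (c x : R) : c <> 0 -> x < 0 ->
  hp (x - c) * hp (x + / c) = hp x * hp (x - / x - (c - / c)).
Proof. intros Hc Hx; rewrite <- !hp_mult; f_equal; field; lra. Qed.

(** Pairing the zeros [- a] with [/ a] and the poles [b] with [- / b] by [hp_pair], the factors
    [hp x] cancel. *)
Lemma f1_joukowski (a b t x : R) : 0 < a -> 0 < b -> 0 < t -> x < 0 ->
  x - / x <> / a - a -> x - / x <> b - / b ->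
  f1 a b t x =
  (1 + / x ^ 2) * flat (t - / t) (/ a - a) (b - / b) (/ a - a) (x - / x).
Proof.
  intros Ha Hb Ht Hx HP HB; rewrite flat_hp by assumption.
  pose proof (hp_pair b x) as E2.
  pose proof (hp_pair (/ a) x) as E1; rewrite Rinv_inv in E1.
  unfold f1, wt; rewrite wt_joukowski by lra.
  (* Splitting [Rabs] into two equal roots lets one of them cancel against the denominator. *)
  rewrite <- hp_sqr.
  assert (0 < hp x) by (apply hp_gt_0; lra).
  assert (0 < hp (x - / x - (/ a - a))) by (apply hp_gt_0; lra).
  assert (0 < hp (x - / x - (b - / b))) by (apply hp_gt_0; lra).
  assert (0 < / a) by (apply Rinv_0_lt_compat; lra).
  specialize (E1 ltac:(lra) Hx); specialize (E2 ltac:(lra) Hx).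
  set (w := hp ((x - / x) ^ 2 - _)) in *.
  transitivity ((hp (x - / a) * hp (x + a)) * / (hp (x - b) * hp (x + / b))
                * / (- x * w)).
  - rewrite (Rinv_mult (hp (x - b))); ring.
  - rewrite E1, E2, !Rinv_mult; unfold Rdiv; rewrite !Rinv_mult.
    generalize (/ w); intros; field; repeat split; lra.
Qed.

Lemma f2_joukowski (a b t x : R) : 0 < a -> 0 < b -> 0 < t -> x < 0 ->
  x - / x <> / a - a -> x - / x <> b - / b ->
  f2 a b t x =
  (1 + / x ^ 2) * flat (t - / t) (/ a - a) (b - / b) (b - / b) (x - / x).
Proof.
  intros Ha Hb Ht Hx HP HB; rewrite flat_hp by assumption.
  pose proof (hp_pair b x) as E2.
  pose proof (hp_pair (/ a) x) as E1; rewrite Rinv_inv in E1.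
  unfold f2, wt; rewrite wt_joukowski by lra.
  rewrite <- hp_sqr.
  assert (0 < hp x) by (apply hp_gt_0; lra).
  assert (0 < hp (x - / x - (/ a - a))) by (apply hp_gt_0; lra).
  assert (0 < hp (x - / x - (b - / b))) by (apply hp_gt_0; lra).
  assert (0 < / a) by (apply Rinv_0_lt_compat; lra).
  specialize (E1 ltac:(lra) Hx); specialize (E2 ltac:(lra) Hx).
  set (w := hp ((x - / x) ^ 2 - _)) in *.
  transitivity ((hp (x - b) * hp (x + / b)) * / (hp (x - / a) * hp (x + a))
                * / (- x * w)).
  - rewrite (Rinv_mult (hp (x - / a))); ring.
  - rewrite E1, E2, !Rinv_mult; unfold Rdiv; rewrite !Rinv_mult.
    generalize (/ w); intros; field; repeat split; lra.
Qed.

Lemma minus_inv_lt (x y : R) : 0 < x < y -> x - / x < y - / y.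
Proof.
  intros H; assert (/ y < / x) by (apply Rinv_lt_contravar; nra); lra.
Qed.

Lemma Q_value_Edge (a b t P B T : R) :
  0 < a -> 0 < b -> 1 < a * b -> a <= b -> b < t ->
  P = / a - a -> B = b - / b -> T = t - / t ->
  Q_value a b t
    ((Edge (- T) P B T P + Edge B T (- T) P P) / Edge P B (- T) T P -
     (Edge (- T) P B T B + Edge B T (- T) P B) / Edge P B (- T) T B).
Proof.
  intros Ha Hb Hab Hle Ht EP EB ET.
  assert (0 < / a) by (apply Rinv_0_lt_compat; lra).
  assert (0 < / b) by (apply Rinv_0_lt_compat; lra).
  assert (0 < / t) by (apply Rinv_0_lt_compat; lra).
  assert (Hba : / b < a).
  { apply Rmult_lt_reg_r with b; [lra |]; rewrite Rinv_l; lra. }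
  assert (Htb : / t < / b) by (apply Rinv_lt_contravar; nra).
  assert (BT : B < T) by (subst; apply minus_inv_lt; lra).
  assert (TP : - T < P) by (subst; pose proof (minus_inv_lt a t); lra).
  assert (PB : P < B).
  { subst; replace (/ a - a) with (- a - / (- a)) by (rewrite Rinv_opp; ring).
    replace (b - / b) with (- / b - / (- / b)) by (rewrite Rinv_opp, Rinv_inv; ring).
    apply joukowski_lt; lra. }
  (* Each branch point is the image of an endpoint on the negative axis: [- t], [- a], [- / b],
     [- / t] in increasing order. *)
  assert (EP' : P = - a - / - a) by (rewrite Rinv_opp; lra).
  assert (EB' : B = - / b - / - / b) by (rewrite Rinv_opp, Rinv_inv; lra).
  assert (ET' : T = - / t - / - / t) by (rewrite Rinv_opp, Rinv_inv; lra).
  assert (ETm : - T = - t - / - t) by (rewrite Rinv_opp; lra).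
  exists (Edge (- T) P B T P), (Edge P B (- T) T P), (Edge B T (- T) P P),
    (Edge (- T) P B T B), (Edge P B (- T) T B), (Edge B T (- T) P B).
  (* Inside an edge the image avoids [P] and [B], where the cancellation of roots would divide by
     zero. *)
  assert (Out : forall C D, C < D < 0 ->
     (D - / D <= P \/ (P <= C - / C /\ D - / D <= B) \/ B <= C - / C) ->
     forall x, C < x < D -> x < 0 /\ x - / x <> P /\ x - / x <> B).
  { intros C D HD Hc x Hx.
    pose proof (joukowski_lt C x); pose proof (joukowski_lt x D); lra. }
  repeat split.
  - apply improper_integral_joukowski; try (unfold outside; lra).
    intros x Hx; rewrite <- flat_dens_left.
    edestruct (Out (- t) (- a)) as [? [? ?]]; [lra | | exact Hx |]; [lra |].
    subst; apply f1_joukowski; lra.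
  - apply improper_integral_joukowski; try (unfold outside; lra).
    intros x Hx; rewrite <- flat_dens_mid.
    edestruct (Out (- a) (- / b)) as [? [? ?]]; [lra | | exact Hx |]; [lra |].
    subst; apply f1_joukowski; lra.
  - apply improper_integral_joukowski; try (unfold outside; lra).
    intros x Hx; rewrite <- flat_dens_right.
    edestruct (Out (- / b) (- / t)) as [? [? ?]]; [lra | | exact Hx |]; [lra |].
    subst; apply f1_joukowski; lra.
  - apply improper_integral_joukowski; try (unfold outside; lra).
    intros x Hx; rewrite <- flat_dens_left.
    edestruct (Out (- t) (- a)) as [? [? ?]]; [lra | | exact Hx |]; [lra |].
    subst; apply f2_joukowski; lra.
  - apply improper_integral_joukowski; try (unfold outside; lra).
    intros x Hx; rewrite <- flat_dens_mid.
    edestruct (Out (- a) (- / b)) as [? [? ?]]; [lra | | exact Hx |]; [lra |].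
    subst; apply f2_joukowski; lra.
  - apply improper_integral_joukowski; try (unfold outside; lra).
    intros x Hx; rewrite <- flat_dens_right.
    edestruct (Out (- / b) (- / t)) as [? [? ?]]; [lra | | exact Hx |]; [lra |].
    subst; apply f2_joukowski; lra.
Qed.

Lemma Q_value_symmetric (a t : R) : 0 < a -> 1 < a * a -> a < t -> Q_value a a t 0.
Proof.
  intros Ha Ha2 Ht.
  set (B := a - / a); set (T := t - / t).
  assert (BT : B < T) by (apply minus_inv_lt; lra).
  assert (Ha1 : / a < a) by
    (apply Rmult_lt_reg_r with a; [lra |]; rewrite Rinv_l; lra).
  assert (0 < B) by (unfold B; lra).
  replace 0 with
    ((Edge (- T) (- B) B T (- B) + Edge B T (- T) (- B) (- B)) / Edge (- B) B (- T) T (- B) -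
     (Edge (- T) (- B) B T B + Edge B T (- T) (- B) B) / Edge (- B) B (- T) T B).
  - apply Q_value_Edge; unfold B, T; lra.
  (* With [P = - B], reflection gives [I1 = J3], [I3 = J1] and [I2 = J2]. *)
  - rewrite <- (Edge_opp B T (- T) (- B) B), <- (Edge_opp B T (- T) (- B) (- B)),
      <- (Edge_opp (- B) B (- T) T B) by (unfold outside; lra).
    rewrite !Ropp_involutive, (Rplus_comm (Edge _ _ _ _ B)); ring.
Qed.

(** The witness is the positive root of [t ^ 2 - T * t - 1 = 0]; monotonicity of [t - / t] places it
    beyond [b]. *)
Lemma exists_minus_inv (b T : R) : 0 < b -> b - / b < T -> exists t, b < t /\ T = t - / t.
Proof.
  intros Hb HT; set (q := sqrt (T * T + 4)).
  assert (Hq : q * q = T * T + 4) by (apply sqrt_sqrt; nra).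
  assert (0 < q) by (apply sqrt_lt_R0; nra).
  assert (Hp : 0 < (T + q) / 2) by nra.
  exists ((T + q) / 2).
  assert (E : T = (T + q) / 2 - / ((T + q) / 2)).
  { apply Rmult_eq_reg_r with ((T + q) / 2); [| lra].
    rewrite Rmult_minus_distr_r, Rinv_l; nra. }
  split; [| exact E].
  destruct (Rlt_le_dec b ((T + q) / 2)) as [| H']; [assumption |].
  destruct H' as [H' | H'].
  - pose proof (minus_inv_lt ((T + q) / 2) b); lra.
  - rewrite H' in E; lra.
Qed.

(** * Bounds on the edge lengths *)

(** The even factor shared by both integrands; reflection then changes only the ratio of the
    distances to [P] and [B]. *)
Definition weight (T s : R) : R := / sqrt (Rabs (s ^ 2 - T ^ 2) * (s ^ 2 + 4)).

(** Valid even for a vanishing root, because [/ 0] is 0; positivity of the integrands therefore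
    needs no case split at branch points. *)
Lemma Rinv_sqrt_ge_0 (x : R) : 0 <= / sqrt x.
Proof.
  destruct (sqrt_pos x) as [H | H].
  - apply Rlt_le, Rinv_0_lt_compat, H.
  - rewrite <- H, Rinv_0; apply Rle_refl.
Qed.

Lemma flat_ge_0 (T P B p s : R) : 0 <= flat T P B p s.
Proof. apply Rmult_le_pos; [apply Rabs_pos | apply Rinv_sqrt_ge_0]. Qed.

Lemma flat_swap (T P B p : R) : flat T P B p = flat T B P p.
Proof.
  apply functional_extensionality; intros s; unfold flat; do 4 f_equal; ring.
Qed.

Lemma flat_sqrt (T P B s : R) : s <> P -> s <> B ->
  flat T P B P s = sqrt (Rabs (s - P) / Rabs (s - B)) * weight T s.
Proof.
  intros HP HB; unfold flat, weight.
  assert (0 < Rabs (s - P)) by (apply Rabs_pos_lt; lra).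
  assert (0 < Rabs (s - B)) by (apply Rabs_pos_lt; lra).
  assert (rP := sqrt_lt_R0 (Rabs (s - P)) ltac:(assumption)).
  assert (rB := sqrt_lt_R0 (Rabs (s - B)) ltac:(assumption)).
  rewrite sqrt_div_alt by assumption.
  rewrite !Rabs_mult, (Rmult_assoc (Rabs (s - P) * Rabs (s - B))).
  rewrite sqrt_mult_alt by nra.
  rewrite sqrt_mult_alt by lra.
  rewrite <- (sqrt_sqrt (Rabs (s - P))) at 1 by lra.
  unfold Rdiv; rewrite !Rinv_mult.
  generalize (/ sqrt (Rabs (s ^ 2 - T ^ 2) * (s ^ 2 + 4))); intros w.
  field; lra.
Qed.

Lemma flat_sqrt_r (T P B s : R) : s <> P -> s <> B ->
  flat T P B B s = sqrt (Rabs (s - B) / Rabs (s - P)) * weight T s.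
Proof. intros; rewrite flat_swap; apply flat_sqrt; assumption. Qed.

Lemma weight_opp (T s : R) : weight T (- s) = weight T s.
Proof. unfold weight; replace ((- s) ^ 2) with (s ^ 2) by ring; reflexivity. Qed.

Lemma weight_ge_0 (T s : R) : 0 <= weight T s.
Proof. apply Rinv_sqrt_ge_0. Qed.

Lemma weight_ge (T s : R) : Rabs s < T -> / (T * (Rabs s + 2)) <= weight T s.
Proof.
  intros Hs; pose proof (Rabs_pos s) as H0.
  assert (E : s ^ 2 = Rabs s * Rabs s)
    by (rewrite <- Rabs_mult, Rabs_pos_eq by nra; ring).
  apply Rinv_le_contravar.
  - apply sqrt_lt_R0, Rmult_lt_0_compat; [apply Rabs_pos_lt | ]; nra.
  - rewrite <- (sqrt_square (T * (Rabs s + 2))) by nra.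
    apply sqrt_le_1_alt; rewrite (Rabs_left (s ^ 2 - T ^ 2)) by nra.
    replace (T * (Rabs s + 2) * (T * (Rabs s + 2)))
      with ((T * T) * ((Rabs s + 2) * (Rabs s + 2))) by ring.
    apply Rmult_le_compat; nra.
Qed.

(** Where [s] is at least as close to [B] as to [P], the ratio under the root is at least 1. *)
Lemma flat_ge_weight (T P B s : R) : s <> P -> s <> B ->
  Rabs (s - B) <= Rabs (s - P) -> weight T s <= flat T P B P s.
Proof.
  intros HP HB H; rewrite flat_sqrt by assumption.
  assert (0 < Rabs (s - B)) by (apply Rabs_pos_lt; lra).
  rewrite <- (Rmult_1_l (weight T s)) at 1.
  apply Rmult_le_compat_r; [apply weight_ge_0 |].
  rewrite <- sqrt_1; apply sqrt_le_1_alt.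
  apply Rmult_le_reg_r with (Rabs (s - B)); [assumption |].
  unfold Rdiv; rewrite Rmult_assoc, Rinv_l; lra.
Qed.

(** * Upper bounds on edge lengths from pointwise bounds on the kernel *)

Lemma kern_le (e f p s M : R) : s <> e -> s <> f -> 0 <= M ->
  (s - p) ^ 2 <= M ^ 2 * (Rabs ((s - e) * (s - f)) * (s ^ 2 + 4)) ->
  kern e f p s <= M.
Proof.
  intros He Hf HM H; unfold kern.
  pose proof (kern_den_gt_0 e f s He Hf) as Hd.
  apply Rmult_le_reg_r with (1 := Hd).
  unfold Rdiv; rewrite Rmult_assoc, Rinv_l, Rmult_1_r by lra.
  rewrite <- (sqrt_pow2 M) at 1 by assumption.
  rewrite <- sqrt_mult_alt by nra.
  rewrite <- sqrt_Rsqr_abs; apply sqrt_le_1_alt; unfold Rsqr; lra.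
Qed.

Lemma Edge_le (c d e f p M : R) : c <= d -> outside e c d -> outside f c d -> 0 <= M ->
  (forall s, c <= s <= d ->
     (s - p) ^ 2 <= M ^ 2 * (Rabs ((s - e) * (s - f)) * (s ^ 2 + 4))) ->
  Edge c d e f p <= PI * M.
Proof.
  intros Hcd He Hf HM H; apply arcmean_le_const; [assumption | |].
  - intros s Hs; apply continuous_kern; apply outside_neq with c d; assumption.
  - intros s Hs; apply kern_le; try (apply outside_neq with c d; assumption); auto.
Qed.

Lemma I1_le (T P B : R) : - B < P < B -> B < T -> Edge (- T) P B T P <= PI.
Proof.
  intros HP HT; rewrite <- (Rmult_1_r PI) at 1.
  apply Edge_le; unfold outside; try lra.
  intros s Hs; rewrite Rabs_pos_eq by nra.
  assert (E : (s - P) ^ 2 <= (s - B) * (s - T)) by nra.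
  assert (0 <= (s - B) * (s - T) * s ^ 2) by (apply Rmult_le_pos; nra).
  nra.
Qed.

Lemma I3_le (T P B : R) : - B < P < B -> B < T -> Edge B T (- T) P P <= PI.
Proof.
  intros HP HT; rewrite <- (Rmult_1_r PI) at 1.
  apply Edge_le; unfold outside; try lra.
  intros s Hs; rewrite Rabs_pos_eq by nra.
  assert (E : (s - P) ^ 2 <= (s - - T) * (s - P)) by nra.
  assert (0 <= (s - - T) * (s - P) * s ^ 2) by (apply Rmult_le_pos; nra).
  nra.
Qed.

(** On [[P, B]], [T ^ 2 - s ^ 2] is at least [B ^ 2 - s ^ 2], hence at least [(B + P) * (B - s)].
    This makes the bound independent of [T], so it survives [T] tending to [B]. *)
Lemma J2_le (T P B : R) : - B < P < B -> B < T ->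
  Edge P B (- T) T B <= PI * (1 + (B - P) / (B + P)).
Proof.
  intros HP HT.
  assert (Hx : 0 < (B - P) / (B + P)) by (apply Rdiv_lt_0_compat; lra).
  set (x := (B - P) / (B + P)) in *.
  assert (Ex : x * (B + P) = B - P) by (unfold x; field; lra).
  apply Edge_le; unfold outside; try lra.
  intros s Hs; rewrite Rabs_left by nra.
  assert (E1 : (B + P) * (B - s) <= - ((s - - T) * (s - T))) by nra.
  assert (E2 : (s - B) ^ 2 <= x * ((B + P) * (B - s))) by nra.
  assert (E3 : 0 <= (B + P) * (B - s)) by nra.
  apply Rle_trans with (1 := E2).
  apply Rmult_le_compat; [lra | assumption | nra |].
  assert (0 <= - ((s - - T) * (s - T)) * s ^ 2) by (apply Rmult_le_pos; nra).
  nra.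
Qed.

Lemma I2_le (T P B : R) : - B < P < B -> 2 * B <= T ->
  Edge P B (- T) T P <= PI * ((B - P) / T).
Proof.
  intros HP HT.
  assert (Hx : 0 < (B - P) / T) by (apply Rdiv_lt_0_compat; lra).
  set (x := (B - P) / T) in *.
  assert (Ex : x * T = B - P) by (unfold x; field; lra).
  apply Edge_le; unfold outside; try lra.
  intros s Hs; rewrite Rabs_left by nra.
  (* Since [2 * B <= T], the factor [T ^ 2 - s ^ 2] keeps three quarters of [T ^ 2]. *)
  assert (E1 : T ^ 2 <= - ((s - - T) * (s - T)) * (s ^ 2 + 4)).
  { assert (3 / 4 * T ^ 2 <= - ((s - - T) * (s - T))) by nra.
    assert (0 <= - ((s - - T) * (s - T)) * s ^ 2) by (apply Rmult_le_pos; nra).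
    nra. }
  apply Rle_trans with ((x * T) ^ 2).
  - rewrite Ex; nra.
  - rewrite Rpow_mult_distr; apply Rmult_le_compat_l; [apply pow2_ge_0 | assumption].
Qed.

(** * Lower bounds on edge lengths from subintervals *)

Lemma improper_flat_left (T P B p : R) : - B < P < B -> B < T ->
  improper_integral (flat T P B p) (- T) P (Edge (- T) P B T p).
Proof.
  intros; rewrite flat_dens_left; apply improper_integral_dens; unfold outside; lra.
Qed.

Lemma improper_flat_mid (T P B p : R) : - B < P < B -> B < T ->
  improper_integral (flat T P B p) P B (Edge P B (- T) T p).
Proof.
  intros; rewrite flat_dens_mid; apply improper_integral_dens; unfold outside; lra.
Qed.

Lemma improper_flat_right (T P B p : R) : - B < P < B -> B < T ->
  improper_integral (flat T P B p) B T (Edge B T (- T) P p).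
Proof.
  intros; rewrite flat_dens_right; apply improper_integral_dens; unfold outside; lra.
Qed.

Lemma J1_ge (T P B : R) : - B < P < B -> B < T ->
  (B + P) / 4 * / (T * (B + 2)) <= Edge (- T) P B T B.
Proof.
  intros HP HT.
  (* The interval [[P - 2 * w, P - w]] lies in [(- B, P)] whatever [T] is; there [weight] is bounded
     below and [P] is nearer than [B]. *)
  set (w := (B + P) / 4).
  apply Rle_trans with (RInt (flat T P B B) (P - 2 * w) (P - w)).
  - replace (w * / (T * (B + 2)))
      with (RInt (fun _ => / (T * (B + 2))) (P - 2 * w) (P - w))
      by (rewrite RInt_const; unfold scal; simpl; unfold mult; simpl; ring).
    apply RInt_le; [unfold w; lra | apply ex_RInt_const | |].
    + apply improper_integral_ex_RInt with (1 := improper_flat_left T P B B HP HT);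
        unfold w; lra.
    + intros s Hs; unfold w in Hs.
      assert (Rabs s <= B) by (apply Rabs_le; lra).
      pose proof (Rabs_pos s).
      apply Rle_trans with (weight T s).
      * apply Rle_trans with (/ (T * (Rabs s + 2))); [| apply weight_ge; lra].
        apply Rinv_le_contravar; nra.
      * rewrite flat_swap; apply flat_ge_weight; try lra.
        rewrite !Rabs_left; lra.
  - apply improper_integral_ge with (1 := improper_flat_left T P B B HP HT);
      try (unfold w; lra); intros; apply flat_ge_0.
Qed.

(** To the right of [B] the integrand dominates [weight], hence [/ (T * (s + 2))], whose integral
    over [[B + 1, T - 1]] is logarithmic in [T]. *)
Lemma I3_ge (T P B : R) : - B < P < B -> B + 2 <= T ->
  ln (T + 1) - ln (B + 3) <= T * Edge B T (- T) P P.
Proof.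
  intros HP HT.
  apply Rle_trans with (T * RInt (flat T P B P) (B + 1) (T - 1)).
  - assert (HI : is_RInt (fun s => / T * / (s + 2)) (B + 1) (T - 1)
              (/ T * ln (T + 1) - / T * ln (B + 3))).
    { replace (T + 1) with (T - 1 + 2) by ring.
      replace (B + 3) with (B + 1 + 2) by ring.
      apply (is_RInt_derive (V := R_CompleteNormedModule)
        (fun s => / T * ln (s + 2)) (fun s => / T * / (s + 2)));
        intros s; rewrite Rmin_left, Rmax_right by lra; intros Hs.
      - auto_derive; [lra | field; lra].
      - apply (ex_derive_continuous (V := R_NormedModule)); auto_derive; lra. }
    replace (ln (T + 1) - ln (B + 3))
      with (T * (/ T * ln (T + 1) - / T * ln (B + 3))) by (field; lra).
    apply Rmult_le_compat_l; [lra |].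
    rewrite <- (is_RInt_unique _ _ _ _ HI).
    apply RInt_le; [lra | eexists; exact HI | |].
    + apply improper_integral_ex_RInt with (1 := improper_flat_right T P B P HP ltac:(lra));
        lra.
    + intros s Hs.
      assert (Es : Rabs s = s) by (apply Rabs_pos_eq; lra).
      apply Rle_trans with (weight T s).
      * rewrite <- Rinv_mult, <- Es at 1; apply weight_ge; lra.
      * apply flat_ge_weight; try lra.
        rewrite !Rabs_pos_eq; lra.
  - apply Rmult_le_compat_l; [lra |].
    apply improper_integral_ge with (1 := improper_flat_right T P B P HP ltac:(lra));
      try lra; intros; apply flat_ge_0.
Qed.

(** From the midpoint of [[P, B]] onwards [s - P] is at least half the length, and [B - s <= T - s].
    Hence the integrand is at least a constant times [/ (T - s)], which produces the logarithm of
    [T - B]. *)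
Lemma I2_ge (T P B : R) : - B < P < B -> B < T -> T <= B + 1 -> T - B <= (B - P) / 2 ->
  sqrt ((B - P) / 2 / ((2 * B + 1) * (B ^ 2 + 4))) *
    (ln ((B - P) / 2) - ln (2 * (T - B))) <= Edge P B (- T) T P.
Proof.
  intros HP HT HT1 HTr.
  set (r := (B - P) / 2) in *.
  set (K := sqrt (r / ((2 * B + 1) * (B ^ 2 + 4)))).
  assert (HK : 0 <= K) by apply sqrt_pos.
  (* Stopping at distance [T - B] before [B] keeps the interval inside the open edge and makes
     [T - y = 2 * (T - B)]. *)
  set (m := (P + B) / 2); set (y := B - (T - B)).
  assert (HI : is_RInt (fun s => K * / (T - s)) m y
              (- K * ln (T - y) - - K * ln (T - m))).
  { apply (is_RInt_derive (V := R_CompleteNormedModule)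
        (fun s => - K * ln (T - s)) (fun s => K * / (T - s)));
      intros s; rewrite Rmin_left, Rmax_right by (unfold m, y, r in *; lra);
      unfold y; intros Hs.
    - auto_derive; [lra | field; lra].
    - apply (ex_derive_continuous (V := R_NormedModule)); auto_derive; lra. }
  assert (Hmr : ln r <= ln (T - m)) by (apply ln_le; unfold r, m; lra).
  apply Rle_trans with (RInt (fun s => K * / (T - s)) m y).
  - rewrite (is_RInt_unique _ _ _ _ HI).
    replace (T - y) with (2 * (T - B)) by (unfold y; ring); nra.
  - apply Rle_trans with (RInt (flat T P B P) m y).
    + apply RInt_le; [unfold m, y, r in *; lra | eexists; exact HI | |].
      * apply improper_integral_ex_RInt with (1 := improper_flat_mid T P B P HP HT);
          unfold m, y, r in *; lra.
      * intros s Hs; unfold m, y, r in Hs.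
        unfold flat; rewrite (Rabs_pos_eq (s - P)) by lra.
        replace ((s - P) * (s - B) * (s ^ 2 - T ^ 2))
          with ((s - P) * ((B - s) * ((T - s) * (T + s)))) by ring.
        rewrite (Rabs_pos_eq ((s - P) * _))
          by (repeat (apply Rmult_le_pos; try lra)).
        assert (D0 : 0 < (B - s) * ((T - s) * (T + s)) * (s ^ 2 + 4))
          by (repeat apply Rmult_lt_0_compat; try lra; nra).
        replace ((s - P) * ((B - s) * ((T - s) * (T + s))) * (s ^ 2 + 4))
          with ((s - P) * ((B - s) * ((T - s) * (T + s)) * (s ^ 2 + 4))) by ring.
        rewrite sqrt_mult_alt by lra.
        rewrite <- (sqrt_sqrt (s - P)) at 1 by lra.
        assert (0 < sqrt (s - P)) by (apply sqrt_lt_R0; lra).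
        assert (Q0 := sqrt_lt_R0 _ D0).
        replace (sqrt (s - P) * sqrt (s - P) /
          (sqrt (s - P) * sqrt ((B - s) * ((T - s) * (T + s)) * (s ^ 2 + 4))))
          with (sqrt (s - P) / sqrt ((B - s) * ((T - s) * (T + s)) * (s ^ 2 + 4)))
          by (field; lra).
        rewrite <- sqrt_div_alt by assumption.
        rewrite <- (sqrt_square (T - s)) at 1 by lra.
        fold (Rdiv K (sqrt ((T - s) * (T - s)))).
        unfold K; rewrite <- sqrt_div_alt by nra.
        apply sqrt_le_1_alt.
        (* Here [2 * B + 1] bounds [T + s] and [B ^ 2 + 4] bounds [s ^ 2 + 4]. *)
        assert (A0 : 0 < (2 * B + 1) * (B ^ 2 + 4)) by nra.
        unfold Rdiv at 1; rewrite (Rmult_comm (r / _)).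
        unfold Rdiv; rewrite (Rmult_comm r), <- Rmult_assoc, <- Rinv_mult.
        rewrite Rmult_comm; apply Rmult_le_compat.
        -- unfold r; lra.
        -- apply Rlt_le, Rinv_0_lt_compat, Rmult_lt_0_compat; nra.
        -- unfold r; lra.
        -- apply Rinv_le_contravar; [assumption |].
           replace ((B - s) * ((T - s) * (T + s)) * (s ^ 2 + 4))
             with (((B - s) * (T - s)) * ((T + s) * (s ^ 2 + 4))) by ring.
           apply Rmult_le_compat; [nra | nra | nra |].
           apply Rmult_le_compat; [lra | nra | lra | nra].
    + apply improper_integral_ge with (1 := improper_flat_mid T P B P HP HT);
        try (unfold m, y, r in *; lra); intros; apply flat_ge_0.
Qed.

(** * Comparison by reflection *)

Lemma Rdiv_le_cross (a b c d : R) : 0 < b -> 0 < d -> a * d <= c * b -> a / b <= c / d.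
Proof.
  intros Hb Hd H; apply Rmult_le_reg_r with (b * d); [nra |].
  replace (a / b * (b * d)) with (a * d) by (field; lra).
  replace (c / d * (b * d)) with (c * b) by (field; lra); assumption.
Qed.

(** After cross-multiplication the claim is [s ^ 2 - B ^ 2 <= s ^ 2 - P ^ 2], as [P] is closer to 0
    than [B]; the companion for [J3] reduces to the same inequality. *)
Lemma flat_reflect_J1 (T P B s : R) : - B < P < B -> B < s ->
  flat T P B B (- s) <= flat T P B P s.
Proof.
  intros HP Hs; rewrite flat_sqrt_r, flat_sqrt, weight_opp by lra.
  apply Rmult_le_compat_r; [apply weight_ge_0 |].
  apply sqrt_le_1_alt.
  rewrite (Rabs_left (- s - B)), (Rabs_left (- s - P)), !Rabs_pos_eq by lra.
  apply Rdiv_le_cross; nra.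
Qed.

Lemma flat_reflect_J3 (T P B s : R) : - B < P < B -> B < s ->
  flat T P B B s <= flat T P B P (- s).
Proof.
  intros HP Hs; rewrite flat_sqrt_r, flat_sqrt, weight_opp by lra.
  apply Rmult_le_compat_r; [apply weight_ge_0 |].
  apply sqrt_le_1_alt.
  rewrite (Rabs_left (- s - B)), (Rabs_left (- s - P)), !Rabs_pos_eq by lra.
  apply Rdiv_le_cross; nra.
Qed.

Lemma is_RInt_reflect_RInt (f : R -> R) (x y : R) : ex_RInt f (- y) (- x) ->
  is_RInt (fun s => f (- s)) x y (RInt f (- y) (- x)).
Proof.
  intros H; apply is_RInt_reflect, (RInt_correct (V := R_CompleteNormedModule)), H.
Qed.

(** Reflection carries [(B, T)] to [(- T, - B)], a part of [(- T, P)] because [- B < P]. *)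
Lemma J3_le_I1 (T P B : R) : - B < P < B -> B < T ->
  Edge B T (- T) P B <= Edge (- T) P B T P.
Proof.
  intros HP HT.
  apply improper_integral_le with (1 := improper_flat_right T P B B HP HT)
    (z := (B + T) / 2); [lra |].
  intros x y Hx Hy.
  assert (HI : is_RInt (fun s => flat T P B P (- s)) x y
                 (RInt (flat T P B P) (- y) (- x))).
  { apply is_RInt_reflect_RInt.
    apply improper_integral_ex_RInt with (1 := improper_flat_left T P B P HP HT); lra. }
  apply Rle_trans with (RInt (fun s => flat T P B P (- s)) x y).
  - apply RInt_le; [lra | | eexists; exact HI |].
    + apply improper_integral_ex_RInt with (1 := improper_flat_right T P B B HP HT); lra.
    + intros; apply flat_reflect_J3; lra.
  - rewrite (is_RInt_unique _ _ _ _ HI).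
    apply improper_integral_ge with (1 := improper_flat_left T P B P HP HT); try lra.
    intros; apply flat_ge_0.
Qed.

Lemma flat_le_inv_sqrt (T P B s : R) : - B < P < B -> 2 * (B + 1) <= T ->
  - (B + 1) <= s < P -> flat T P B B s <= sqrt (2 * B + 1) / T * / sqrt (P - s).
Proof.
  intros HP HT Hs; rewrite flat_sqrt_r by lra.
  rewrite !Rabs_left, sqrt_div_alt by lra.
  replace (- (s - B)) with (B - s) by ring; replace (- (s - P)) with (P - s) by ring.
  replace (sqrt (2 * B + 1) / T * / sqrt (P - s))
    with (sqrt (2 * B + 1) / sqrt (P - s) * / T) by (unfold Rdiv; ring).
  apply Rmult_le_compat.
  - apply Rmult_le_pos; [apply sqrt_pos | apply Rinv_sqrt_ge_0].
  - apply weight_ge_0.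
  - apply Rmult_le_compat_r; [apply Rinv_sqrt_ge_0 | apply sqrt_le_1_alt; lra].
  - apply Rinv_le_contravar; [lra |].
    rewrite <- (sqrt_square T) at 1 by lra.
    apply sqrt_le_1_alt.
    assert (3 / 4 * T ^ 2 <= T ^ 2 - s ^ 2) by nra.
    rewrite Rabs_left by nra.
    assert (0 <= (T ^ 2 - s ^ 2) * s ^ 2) by (apply Rmult_le_pos; nra).
    nra.
Qed.

(** Reflection compares only the part left of [- B]. The integral is cut at [- (B + 1)]; on the rest
    the integrable singularity at [P] has size [1 / T] and is integrated explicitly. *)
Lemma J1_le (T P B : R) : - B < P < B -> 2 * (B + 1) <= T ->
  Edge (- T) P B T B <=
  Edge B T (- T) P P + 2 * sqrt (2 * B + 1) * sqrt (P + B + 1) / T.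
Proof.
  intros HP HT.
  assert (HT' : B < T) by lra.
  apply improper_integral_le with (1 := improper_flat_left T P B B HP HT')
    (z := - (B + 1)); [lra |].
  intros x y Hx Hy.
  assert (E : forall u v, - T < u -> u <= v -> v < P -> ex_RInt (flat T P B B) u v)
    by (intros; apply improper_integral_ex_RInt with (1 := improper_flat_left T P B B HP HT'); lra).
  rewrite <- (RInt_Chasles (flat T P B B) x (- (B + 1)) y) by (apply E; lra).
  apply Rplus_le_compat.
  - assert (HI : is_RInt (fun s => flat T P B B (- s)) (B + 1) (- x)
                   (RInt (flat T P B B) (- - x) (- (B + 1))))
      by (apply is_RInt_reflect_RInt, E; lra).
    rewrite Ropp_involutive in HI.
    rewrite <- (is_RInt_unique _ _ _ _ HI).
    apply Rle_trans with (RInt (flat T P B P) (B + 1) (- x)).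
    + apply RInt_le; [lra | eexists; exact HI | |].
      * apply improper_integral_ex_RInt with (1 := improper_flat_right T P B P HP HT'); lra.
      * intros; apply flat_reflect_J1; lra.
    + apply improper_integral_ge with (1 := improper_flat_right T P B P HP HT'); try lra.
      intros; apply flat_ge_0.
  - set (K := sqrt (2 * B + 1) / T).
    assert (HK : 0 <= K).
    { apply Rmult_le_pos; [apply sqrt_pos | apply Rlt_le, Rinv_0_lt_compat; lra]. }
    assert (HI : is_RInt (fun s => K * / sqrt (P - s)) (- (B + 1)) y
                   (- 2 * K * sqrt (P - y) - - 2 * K * sqrt (P - - (B + 1)))).
    { apply (is_RInt_derive (V := R_CompleteNormedModule)
        (fun s => - 2 * K * sqrt (P - s)) (fun s => K * / sqrt (P - s)));
        intros s; rewrite Rmin_left, Rmax_right by lra; intros Hs;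
        (assert (0 < sqrt (P - s)) by (apply sqrt_lt_R0; lra)).
      - auto_derive; [lra |].
        change (P + - s) with (P - s); field; lra.
      - apply (ex_derive_continuous (V := R_NormedModule) (fun s => K * / sqrt (P - s))).
        auto_derive; change (P + - s) with (P - s); repeat split; lra. }
    apply Rle_trans with (RInt (fun s => K * / sqrt (P - s)) (- (B + 1)) y).
    + apply RInt_le; [lra | apply E; lra | eexists; exact HI |].
      intros; apply flat_le_inv_sqrt; lra.
    + rewrite (is_RInt_unique _ _ _ _ HI).
      replace (P - - (B + 1)) with (P + B + 1) by ring.
      replace (2 * sqrt (2 * B + 1) * sqrt (P + B + 1) / T)
        with (2 * K * sqrt (P + B + 1)) by (unfold K, Rdiv; ring).
      pose proof (sqrt_pos (P - y)); nra.
Qed.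

(** * Sign change of the period determinant *)

(* The value of [T * (J2 - I2)] in the limit [T = infinity]. *)
Definition gap (P B : R) : R :=
  arcmean P B (fun s => (B + P - 2 * s) / sqrt (s ^ 2 + 4)).

Lemma continuous_gap (P B s : R) :
  continuous (fun s => (B + P - 2 * s) / sqrt (s ^ 2 + 4)) s.
Proof.
  apply (ex_derive_continuous (V := R_NormedModule)); auto_derive.
  assert (0 < s * (s * 1) + 4) by nra.
  repeat split; [assumption | apply Rgt_not_eq, sqrt_lt_R0; assumption].
Qed.

(* [s -> 1 / sqrt (s^2 + 4)] is even and decreasing in [|s|], and the centre
   [(P + B) / 2] of the interval is positive, so in the pair of points at
   distance [r] from the centre the left one, where [B + P - 2 s > 0], wins. *)
Lemma gap_gt_0 (P B : R) : - B < P < B -> 0 < gap P B.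
Proof.
  intros HP; unfold gap, arcmean; pose proof PI_RGT_0.
  set (z := fun u : R => _).
  assert (zc : forall u, continuous z u)
    by (intros; apply (continuous_arc P B (fun s => (B + P - 2 * s) / sqrt (s ^ 2 + 4)));
        [lra | intros; apply continuous_gap]).
  assert (zi : forall u v, ex_RInt z u v)
    by (intros; apply (ex_RInt_continuous (V := R_CompleteNormedModule)); intros; apply zc).
  rewrite <- (RInt_Chasles z _ 0) by apply zi.
  assert (HI : is_RInt (fun u => z (- u)) 0 (PI / 2) (RInt z (- (PI / 2)) 0)).
  { rewrite <- Ropp_0 at 2; apply is_RInt_reflect_RInt, zi. }
  rewrite <- (is_RInt_unique _ _ _ _ HI).
  rewrite <- (RInt_plus (V := R_CompleteNormedModule))
    by (apply zi || (eexists; exact HI)).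
  apply RInt_gt_0; [lra | |].
  - intros u Hu; unfold plus; simpl; unfold z; rewrite sin_neg.
    assert (0 < sin u) by (apply sin_gt_0; lra).
    set (m := (P + B) / 2); set (r := (B - P) / 2 * sin u).
    assert (0 < m) by (unfold m; lra).
    assert (0 < r) by (unfold r; nra).
    replace (m + (B - P) / 2 * - sin u) with (m - r) by (unfold r; ring).
    replace (B + P - 2 * (m - r)) with (2 * r) by (unfold m; field).
    replace (B + P - 2 * (m + r)) with (- (2 * r)) by (unfold m; field).
    assert (/ sqrt ((m + r) ^ 2 + 4) < / sqrt ((m - r) ^ 2 + 4)).
    { pose proof (pow2_ge_0 (m - r)).
      assert (0 < sqrt ((m - r) ^ 2 + 4)) by (apply sqrt_lt_R0; lra).
      assert (sqrt ((m - r) ^ 2 + 4) < sqrt ((m + r) ^ 2 + 4))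
        by (apply sqrt_lt_1; nra).
      apply Rinv_lt_contravar; nra. }
    unfold Rdiv; nra.
  - intros u Hu; apply (continuous_plus (V := R_NormedModule)); [| apply zc].
    apply (continuous_comp Ropp z); [| apply zc].
    apply (continuous_opp (V := R_NormedModule)), continuous_id.
Qed.

(** The numerators differ by [(B - s) - (s - P) = B + P - 2 * s]. Replacing
    [q = T / sqrt (T ^ 2 - s ^ 2)] by 1 costs at most [2 * e] with [e = s ^ 2 / T ^ 2], and the
    other root contributes at most one half. *)
Lemma kern_diff_ge (T P B s : R) : - B < P < B -> 2 * B <= T -> P <= s <= B ->
  (B + P - 2 * s) / sqrt (s ^ 2 + 4) - (B - P) * B ^ 2 / T ^ 2 <=
  T * (kern (- T) T B s - kern (- T) T P s).
Proof.
  intros HP HT Hs; unfold kern.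
  rewrite (Rabs_pos_eq (s - P)), (Rabs_left1 (s - B)) by lra.
  rewrite (Rabs_left ((s - - T) * (s - T))) by nra.
  replace (- ((s - - T) * (s - T))) with (T ^ 2 - s ^ 2) by ring.
  assert (HB : s ^ 2 <= B ^ 2) by nra.
  assert (HD : 0 < T ^ 2 - s ^ 2) by nra.
  rewrite sqrt_mult_alt by lra.
  assert (r2 : 2 <= sqrt (s ^ 2 + 4)).
  { rewrite <- (sqrt_square 2) by lra; apply sqrt_le_1_alt; nra. }
  assert (d0 := sqrt_lt_R0 _ HD).
  set (x := / sqrt (s ^ 2 + 4)).
  assert (Hx : 0 < x <= / 2).
  { split; [apply Rinv_0_lt_compat; lra | apply Rinv_le_contravar; lra]. }
  set (q := T / sqrt (T ^ 2 - s ^ 2)).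
  set (e := s ^ 2 / T ^ 2).
  assert (He : 0 <= e <= 1 / 4).
  { unfold e; split.
    - apply Rdiv_le_0_compat; nra.
    - apply Rmult_le_reg_r with (T ^ 2); [nra |].
      unfold Rdiv at 1; rewrite Rmult_assoc, Rinv_l; nra. }
  assert (Hee : e <= B ^ 2 / T ^ 2).
  { apply Rmult_le_compat_r; [| assumption].
    apply Rlt_le, Rinv_0_lt_compat; nra. }
  assert (Hq : q ^ 2 * (1 - e) = 1).
  { unfold q, e, Rdiv; rewrite Rpow_mult_distr, pow_inv, pow2_sqrt by lra.
    field; split; nra. }
  assert (Hq0 : 0 < q) by (apply Rdiv_lt_0_compat; lra).
  assert (Hq1 : 1 <= q) by nra.
  (* For [e] in [[0, 1/4]], [(1 + 2 * e) ^ 2 * (1 - e)] is at least 1, so a larger [q] would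
     contradict [Hq]. *)
  assert (Hq2 : q <= 1 + 2 * e).
  { destruct (Rle_dec q (1 + 2 * e)); [assumption | exfalso].
    assert ((1 + 2 * e) ^ 2 < q ^ 2) by nra.
    assert (1 <= (1 + 2 * e) ^ 2 * (1 - e)) by nra.
    nra. }
  replace (T * _) with ((B + P - 2 * s) * x * q).
  2: { unfold x, q; field; split; lra. }
  replace ((B + P - 2 * s) / sqrt (s ^ 2 + 4)) with ((B + P - 2 * s) * x) by reflexivity.
  replace ((B - P) * B ^ 2 / T ^ 2) with ((B - P) * (B ^ 2 / T ^ 2)) by (unfold Rdiv; ring).
  set (w := B ^ 2 / T ^ 2) in *.
  enough (- ((B - P) * w) <= (B + P - 2 * s) * (x * (q - 1))) by nra.
  assert (H1 : 0 <= x * (q - 1) <= w) by (split; nra).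
  assert (H2 : - (B - P) <= B + P - 2 * s <= B - P) by lra.
  nra.
Qed.

Lemma J2_I2_ge (T P B : R) : - B < P < B -> 2 * B <= T ->
  gap P B - PI * ((B - P) * B ^ 2 / T ^ 2) <=
  T * (Edge P B (- T) T B - Edge P B (- T) T P).
Proof.
  intros HP HT; unfold gap, Edge, arcmean; pose proof PI_RGT_0.
  set (K := (B - P) * B ^ 2 / T ^ 2).
  assert (kc : forall p s, P <= s <= B -> continuous (kern (- T) T p) s)
    by (intros; apply continuous_kern; lra).
  set (z := fun u : R => _ / _).
  assert (zi : is_RInt z (- (PI / 2)) (PI / 2) (RInt z (- (PI / 2)) (PI / 2))).
  { apply (RInt_correct (V := R_CompleteNormedModule)).
    apply (ex_RInt_arc P B (fun s => (B + P - 2 * s) / sqrt (s ^ 2 + 4)));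
      [lra | intros; apply continuous_gap]. }
  set (kB := fun u : R => kern _ _ B _); set (kP := fun u : R => kern _ _ P _).
  assert (iB : is_RInt kB (- (PI / 2)) (PI / 2) (RInt kB (- (PI / 2)) (PI / 2))).
  { apply (RInt_correct (V := R_CompleteNormedModule)).
    apply ex_RInt_arc; [lra | apply kc]. }
  assert (iP : is_RInt kP (- (PI / 2)) (PI / 2) (RInt kP (- (PI / 2)) (PI / 2))).
  { apply (RInt_correct (V := R_CompleteNormedModule)).
    apply ex_RInt_arc; [lra | apply kc]. }
  assert (iK : is_RInt (fun _ => K) (- (PI / 2)) (PI / 2) (PI * K)).
  { replace (PI * K) with (scal (PI / 2 - - (PI / 2)) K)
      by (unfold scal; simpl; unfold mult; simpl; field).
    apply (is_RInt_const (V := R_NormedModule)). }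
  apply (is_RInt_le (fun u => minus (z u) K)
           (fun u => scal T (minus (kB u) (kP u))) (- (PI / 2)) (PI / 2)).
  - lra.
  - apply (is_RInt_minus (V := R_NormedModule)); assumption.
  - apply (is_RInt_scal (V := R_NormedModule)), (is_RInt_minus (V := R_NormedModule));
      assumption.
  - intros u Hu; apply kern_diff_ge; [assumption | assumption | apply arc_between; lra].
Qed.

(** The period function multiplied by its positive denominators [I2 * J2]. *)
Definition det (P B T : R) : R :=
  (Edge (- T) P B T P + Edge B T (- T) P P) * Edge P B (- T) T B -
  (Edge (- T) P B T B + Edge B T (- T) P B) * Edge P B (- T) T P.

Lemma continuity_det (P B T : R) : - B < P < B -> B < T -> continuity_pt (det P B) T.
Proof.
  intros HP HT.
  assert (Cid : continuity (fun v => v)) by (intros v; reg).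
  assert (Cop : continuity (fun v => - v)) by (intros v; reg).
  assert (Cc : forall k, continuity (fun _ => k)) by (intros k v; reg).
  assert (C1 : forall p, continuity_pt (fun v => Edge (- v) P B v p) T).
  { intros p; apply (continuity_Edge (fun v => - v) (fun _ => P) (fun _ => B) (fun v => v) p B);
      auto; unfold outside; intros; lra. }
  assert (C2 : forall p, continuity_pt (fun v => Edge P B (- v) v p) T).
  { intros p; apply (continuity_Edge (fun _ => P) (fun _ => B) (fun v => - v) (fun v => v) p B);
      auto; unfold outside; intros; lra. }
  assert (C3 : forall p, continuity_pt (fun v => Edge B v (- v) P p) T).
  { intros p; apply (continuity_Edge (fun _ => B) (fun v => v) (fun v => - v) (fun _ => P) p B);
      auto; unfold outside; intros; lra. }
  apply (continuity_pt_minus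
    (fun T => (Edge (- T) P B T P + Edge B T (- T) P P) * Edge P B (- T) T B)
    (fun T => (Edge (- T) P B T B + Edge B T (- T) P B) * Edge P B (- T) T P)).
  - apply (continuity_pt_mult
      (fun T => Edge (- T) P B T P + Edge B T (- T) P P) (fun T => Edge P B (- T) T B));
      [apply (continuity_pt_plus (fun T => Edge (- T) P B T P) (fun T => Edge B T (- T) P P)) |];
      auto.
  - apply (continuity_pt_mult
      (fun T => Edge (- T) P B T B + Edge B T (- T) P B) (fun T => Edge P B (- T) T P));
      [apply (continuity_pt_plus (fun T => Edge (- T) P B T B) (fun T => Edge B T (- T) P B)) |];
      auto.
Qed.

Lemma det_neg_near (P B : R) : - B < P < B -> exists T, B < T <= B + 1 /\ det P B T < 0.
Proof.
  intros HP; pose proof PI_RGT_0 as Hpi.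
  set (c := (B + P) / 4 * / ((B + 1) * (B + 2))).
  assert (Hc : 0 < c).
  { apply Rmult_lt_0_compat; [lra | apply Rinv_0_lt_compat; nra]. }
  set (M := PI * (1 + (B - P) / (B + P))).
  set (r := (B - P) / 2).
  set (K := sqrt (r / ((2 * B + 1) * (B ^ 2 + 4)))).
  assert (HK : 0 < K).
  { apply sqrt_lt_R0, Rdiv_lt_0_compat; [unfold r; lra | nra]. }
  (* The bounds give [det <= 2 * PI * M - c * I2], negative once [I2] exceeds [Z]. In [d], the terms
     1 and [r] meet the hypotheses of [I2_ge], and the exponential makes [ln r - ln (2 * d)] at
     least [Z / K + 1]. *)
  set (Z := 2 * PI * M / c).
  set (d := Rmin (Rmin 1 r) (exp (ln r - Z / K - 1) / 2)).
  assert (Hd : 0 < d).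
  { repeat apply Rmin_glb_lt; try (unfold r; lra).
    apply Rdiv_lt_0_compat; [apply exp_pos | lra]. }
  assert (d <= exp (ln r - Z / K - 1) / 2) by apply Rmin_r.
  assert (d <= Rmin 1 r) by apply Rmin_l.
  pose proof (Rmin_l 1 r); pose proof (Rmin_r 1 r).
  exists (B + d); split; [lra |].
  set (T := B + d).
  assert (HT : B < T) by (unfold T; lra).
  pose proof (I1_le T P B HP HT); pose proof (I3_le T P B HP HT).
  pose proof (J2_le T P B HP HT) as HJ2; fold M in HJ2.
  assert (HJ1 : c <= Edge (- T) P B T B).
  { apply Rle_trans with (2 := J1_ge T P B HP HT).
    apply Rmult_le_compat_l; [lra |].
    apply Rinv_le_contravar; [unfold T; nra |].
    apply Rmult_le_compat_r; unfold T; lra. }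
  assert (HI2 : Z < Edge P B (- T) T P).
  { eapply Rlt_le_trans; [| apply I2_ge; unfold T; fold r; lra].
    fold r; fold K; replace (T - B) with d by (unfold T; ring).
    assert (ln (2 * d) <= ln r - Z / K - 1).
    { rewrite <- (ln_exp (ln r - Z / K - 1)); apply ln_le; lra. }
    apply Rlt_le_trans with (K * (Z / K + 1)).
    - replace (K * (Z / K + 1)) with (Z + K) by (field; lra); lra.
    - apply Rmult_le_compat_l; lra. }
  assert (0 < Edge P B (- T) T B) by (apply Edge_gt_0; unfold outside; lra).
  assert (0 < Edge P B (- T) T P) by (apply Edge_gt_0; unfold outside; lra).
  assert (0 < Edge B T (- T) P B) by (apply Edge_gt_0; unfold outside; lra).
  assert (HZ : 2 * PI * M = c * Z) by (unfold Z; field; lra).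
  unfold det.
  apply Rle_lt_trans with (2 * PI * M - c * Edge P B (- T) T P); [| nra].
  apply Rplus_le_compat; [nra |].
  apply Ropp_le_contravar; nra.
Qed.

Lemma det_pos_far (P B : R) : - B < P < B -> exists T, B + 1 < T /\ 0 < det P B T.
Proof.
  intros HP; pose proof PI_RGT_0 as Hpi.
  pose proof (gap_gt_0 P B HP) as HG; set (G := gap P B) in *.
  set (X := 2 * sqrt (2 * B + 1) * sqrt (P + B + 1)).
  set (A := PI * ((B - P) * B ^ 2)).
  assert (HA : 0 < A) by (apply Rmult_lt_0_compat; [lra | apply Rmult_lt_0_compat; nra]).
  (* The threshold for [T * I3] at which [Z * (G / 2)] matches [X * (PI * (B - P))], the bound on
     the subtracted term. In [T], the first summand serves the edge bounds, [2 * A / G + 1] keeps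
     the error of [J2_I2_ge] below [G / 2], and the exponential pushes [T * I3] past [Z]. *)
  set (Z := 2 * X * (PI * (B - P)) / G).
  set (T := 2 * (B + 1) + 2 * A / G + 1 + exp (ln (B + 3) + Z + 1)).
  assert (HAG : 0 < 2 * A / G) by (apply Rdiv_lt_0_compat; lra).
  pose proof (exp_pos (ln (B + 3) + Z + 1)) as He.
  assert (HTB : 2 * (B + 1) <= T) by (unfold T; lra).
  exists T; split; [lra |].
  assert (HT : B < T) by lra.
  assert (HI3 : Z < T * Edge B T (- T) P P).
  { eapply Rlt_le_trans; [| apply I3_ge; lra].
    assert (ln (exp (ln (B + 3) + Z + 1)) <= ln (T + 1))
      by (apply ln_le; unfold T; lra).
    rewrite ln_exp in *; lra. }
  assert (Hgap : G / 2 <= T * (Edge P B (- T) T B - Edge P B (- T) T P)).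
  { eapply Rle_trans; [| apply J2_I2_ge; lra].
    fold G.
    assert (PI * ((B - P) * B ^ 2 / T ^ 2) <= G / 2); [| lra].
    replace (PI * ((B - P) * B ^ 2 / T ^ 2)) with (A / T ^ 2) by (unfold A, Rdiv; ring).
    apply Rmult_le_reg_r with (T ^ 2); [nra |].
    replace (A / T ^ 2 * T ^ 2) with A by (field; lra).
    assert (2 * A / G * G = 2 * A) by (field; lra).
    assert (2 * A / G <= T ^ 2) by (unfold T in *; nra).
    nra. }
  pose proof (I2_le T P B HP ltac:(lra)) as HI2.
  pose proof (J1_le T P B HP HTB) as HJ1; fold X in HJ1.
  pose proof (J3_le_I1 T P B HP HT) as HJ3.
  assert (i1 : 0 < Edge (- T) P B T P) by (apply Edge_gt_0; unfold outside; lra).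
  assert (i2 : 0 < Edge P B (- T) T P) by (apply Edge_gt_0; unfold outside; lra).
  assert (i3 : 0 < Edge B T (- T) P P) by (apply Edge_gt_0; unfold outside; lra).
  unfold det.
  set (I1 := Edge (- T) P B T P) in *; set (I2 := Edge P B (- T) T P) in *;
  set (I3 := Edge B T (- T) P P) in *; set (J1 := Edge (- T) P B T B) in *;
  set (J2 := Edge P B (- T) T B) in *; set (J3 := Edge B T (- T) P B) in *.
  assert (HI2' : T * I2 <= PI * (B - P)).
  { replace (PI * (B - P)) with (T * (PI * ((B - P) / T))) by (field; lra).
    apply Rmult_le_compat_l; lra. }
  assert (HJ1' : T * J1 <= T * I3 + X).
  { replace (T * I3 + X) with (T * (I3 + X / T)) by (field; lra).
    apply Rmult_le_compat_l; lra. }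
  assert (HX : 0 <= X).
  { unfold X; repeat apply Rmult_le_pos; try apply sqrt_pos; lra. }
  assert (HZ : Z * (G / 2) = X * (PI * (B - P))) by (unfold Z; field; lra).
  apply Rmult_lt_reg_l with (T * T); [nra |]; rewrite Rmult_0_r.
  (* Rewriting through [J2 - I2], [J1 - I3] and [J3 - I1] isolates a product growing like [T * I3]
     from a bounded remainder. *)
  replace (T * T * ((I1 + I3) * J2 - (J1 + J3) * I2))
    with ((T * I1 + T * I3) * (T * (J2 - I2)) -
          (T * (J1 - I3) + T * (J3 - I1)) * (T * I2)) by ring.
  assert (T * (J1 - I3) + T * (J3 - I1) <= X) by nra.
  assert ((T * (J1 - I3) + T * (J3 - I1)) * (T * I2) <= X * (PI * (B - P))).
  { apply Rle_trans with (X * (T * I2)).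
    - apply Rmult_le_compat_r; [nra | assumption].
    - apply Rmult_le_compat_l; assumption. }
  assert (Z * (G / 2) < (T * I1 + T * I3) * (T * (J2 - I2))); [| lra].
  apply Rlt_le_trans with (T * I3 * (G / 2)); [nra |].
  apply Rmult_le_compat; nra.
Qed.

Theorem mainTheorem6 (a b : R) (ha : 0 < a) (hb : 0 < b) (hab : 1 < a * b) :
  (a = b -> forall t : R, b < t -> Q_value a b t 0) /\
  (a < b -> exists t : R, b < t /\ Q_value a b t 0).
Proof.
  split.
  - intros <- t Ht; apply Q_value_symmetric; assumption.
  - intros Hlt.
    set (P := / a - a); set (B := b - / b).
    assert (0 < / b) by (apply Rinv_0_lt_compat; assumption).
    assert (/ b < a) by (apply Rmult_lt_reg_r with b; [| rewrite Rinv_l]; lra).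
    (* The left inequality encodes [a < b], the right one [1 < a * b]. *)
    assert (HP : - B < P < B).
    { split; unfold P, B.
      - pose proof (minus_inv_lt a b); lra.
      - pose proof (minus_inv_lt (/ b) a) as Hm; rewrite Rinv_inv in Hm; lra. }
    destruct (det_neg_near P B HP) as [T1 [HT1 D1]].
    destruct (det_pos_far P B HP) as [T2 [HT2 D2]].
    (* The points are ordered by [T1 <= B + 1 < T2], and the whole interval lies beyond [B], where
       [det] is continuous. *)
    destruct (IVT_interv (det P B) T1 T2) as [T [HT DT]]; try assumption; try lra.
    { intros v Hv; apply continuity_det; [assumption | lra]. }
    destruct (exists_minus_inv b T hb) as [t [Ht ET]]; [unfold B in *; lra |].
    exists t; split; [assumption |].
    assert (0 < Edge P B (- T) T B) by (apply Edge_gt_0; unfold outside; lra).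
    assert (0 < Edge P B (- T) T P) by (apply Edge_gt_0; unfold outside; lra).
    replace 0 with (det P B T / (Edge P B (- T) T P * Edge P B (- T) T B))
      by (rewrite DT; unfold Rdiv; ring).
    replace (det P B T / (Edge P B (- T) T P * Edge P B (- T) T B)) with
     ((Edge (- T) P B T P + Edge B T (- T) P P) / Edge P B (- T) T P -
     (Edge (- T) P B T B + Edge B T (- T) P B) / Edge P B (- T) T B)
      by (unfold det; field; lra).
    apply Q_value_Edge; try assumption; try reflexivity; lra.
Qed.
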